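(* Let $\mu,v\in\mathbb R$ and $t>0$. For all $\eta>0$, $$ \lim_{\delta\to0}\ \lim_{u\downarrow v}\ P\Big(\max_{0\le z\le\delta}|B^\mu(z)-B^\mu(0)|<\eta\ \Big|\ \min_{0\le z\le t}B^\mu(z)>v,\ B^\mu(0)=u\Big)=1 . $$
   Context: $B$ is a standard one-dimensional Brownian motion and $B^\mu(t)=B(t)+\mu t$ is Brownian motion with drift $\mu$; conditioning on $B^\mu(0)=u$ means that the process is started at $u$, and for $u>v$ the event $\{\min_{0\le z\le t}B^\mu(z)>v\}$ has positive probability and is conditioned on in the elementary sense. Here $\delta$ ranges over $(0,t)$. *)

(* Defs.v *)
From HB Require Import structures.
From mathcomp Require Import all_boot all_order all_algebra.
From mathcomp Require Import all_classical all_reals all_analysis.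
Import Order.TTheory GRing.Theory Num.Theory.
Import numFieldNormedType.Exports.

Set Implicit Arguments.
Unset Strict Implicit.
Unset Printing Implicit Defensive.

Local Open Scope classical_set_scope.
Local Open Scope ring_scope.

(* Since [A i = setT] is allowed, the product rule over the whole index type
   contains the product rule over every subfamily. *)
Definition mutually_independent (d : measure_display) (T : measurableType d)
    (R : realType) (P : probability T R) (I : finType) (X : I -> T -> R) : Prop :=
  forall A : I -> set R, (forall i, measurable (A i)) ->
    P [set w | forall i, A i (X i w)] = (\prod_i P (X i @^-1` A i))%E.

(* The time set is [0, +oo[; the values of [B] at negative times are
   unconstrained. The second argument of [normal_prob] is the standard
   deviation. *)
Record standard_brownian_motion (d : measure_display) (T : measurableType d)
    (R : realType) (P : probability T R) (B : R -> {RV P >-> R}) : Prop := {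
  bm_start : {ae P, forall w, B 0 w = 0};
  bm_indep : forall (n : nat) (s : nat -> R),
    0 <= s 0%N -> (forall i, s i <= s i.+1) ->
    mutually_independent P (fun (i : 'I_n) w => B (s i.+1) w - B (s i) w);
  bm_gauss : forall r s : R, 0 <= r -> r < s ->
    forall A : set R, measurable A ->
    P ((fun w => B s w - B r w) @^-1` A) = normal_prob 0 (Num.sqrt (s - r)) A;
  bm_continuous : forall w, {within `[0, +oo[, continuous (fun z : R => B z w)} }.

Definition drifted (d : measure_display) (T : measurableType d)
    (R : realType) (P : probability T R) (B : R -> {RV P >-> R})
    (mu u : R) (z : R) (w : T) : R :=
  u + B z w + mu * z.

Definition cond_prob (d : measure_display) (T : measurableType d)
    (R : realType) (P : probability T R) (A C : set T) : R :=
  fine (P (A `&` C)) / fine (P C).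

(* For a path [x] continuous on [`[a, b]] with [a <= b], the supremum and the
   infimum below are attained. *)
Definition path_max (R : realType) (x : R -> R) (a b : R) : R :=
  sup [set x z | z in `[a, b]].

Definition path_min (R : realType) (x : R -> R) (a b : R) : R :=
  inf [set x z | z in `[a, b]].

(* Main.v *)
Require Import Defs.
From HB Require Import structures.
From mathcomp Require Import all_boot all_order all_algebra.
From mathcomp Require Import all_classical all_reals all_analysis.
From mathcomp Require Import measurable_realfun ring lra.
Import Order.TTheory GRing.Theory Num.Theory.
Import numFieldNormedType.Exports.

Set Implicit Arguments.
Unset Strict Implicit.
Unset Printing Implicit Defensive.

Local Open Scope classical_set_scope.
Local Open Scope ring_scope.

(** Write [X z = B z - B 0 + mu z] for the displacement, [a = u - v], and, for
    a barrier [- a] and a level [c], let [F a c] be the probability that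
    [X > - a] on [[0, t]] and [X < c] on [[0, delta]], and [G a] the probability
    that [X > - a] on [[0, t]].  As soon as [a <= eta], the lower half of the
    constraint [|X| < eta] follows from the conditioning, so the conditional
    probability is the ratio [F a eta / G a].

    The engine is a correlation inequality of Ahlswede-Daykin (four functions)
    type for Gaussian random walks.  The transition density is log-concave in
    the step, hence totally positive of order two in (starting point, end
    point); integrating the four functions inequality step by step
    ([four_functions], [killed_op_four]) gives, for walks started at [x1] and
    [x2] and constrained by barriers [l1] and [l2] from below and [h] from above,
    an inequality between products of survival probabilities in which starting
    points and lower barriers are replaced by their minima and maxima.  Passing
    from grids to continuous time ([open_tube_four]) yields two facts.

    - Same starting point, two barriers: [F a eta / G a] is nondecreasing in
      [a].  Being bounded, it has a limit as [a] decreases to [0]; this is the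
      inner limit.
    - Same barrier, starting points [b] and [0], where [b = eta / 2]: raising the
      starting point makes it less likely to remain below [eta], so
      [F a eta / G a >= F (a + b) (eta - b) / G (a + b)], and the right-hand side
      is at least [1 - (1 - Q delta) / G b], where [Q delta] is the probability
      that [X < b] on [[0, delta]].  This bound does not depend on [a], and
      [Q delta] tends to [1] by continuity of the paths.

    All this needs [G b > 0].  Positive correlation (again the four functions
    inequality) between [X >= - b] on [[0, s]] and [X s >= 0], followed by the
    Markov property at time [s], bounds [G] over [[0, 2 s]] from below by the
    square of [G] over [[0, s]] times [P (X s >= 0)]; since [G] over short
    intervals is close to [1], doubling reaches every horizon
    ([pr_ge_on_gt0]).

    The drift enters only through the mean of the Gaussian steps, which does not
    affect total positivity. *)

(** * The four functions inequality on the line *)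

(** Expand [(c - a) * (c - b) >= 0] and divide by [c]. *)
Lemma addr_le_of_mulr_le (R : realFieldType) (a b c e : R) :
  0 <= a -> 0 <= b -> 0 <= c -> 0 <= e ->
  a <= c -> b <= c -> a * b <= c * e -> a + b <= c + e.
Proof.
move=> a0 b0 c0 e0 ac bc abce.
have [c00|cn0] := eqVneq c 0; first by lra.
have cgt0 : 0 < c by rewrite lt_def cn0.
rewrite -(ler_pM2l cgt0).
have : 0 <= (c - a) * (c - b) by apply: mulr_ge0; rewrite subr_ge0.
by nra.
Qed.

Section four_functions.
Context {R : realType}.
Local Open Scope ereal_scope.
Variable mu : {measure set (measurableTypeR R) -> \bar R}.

Lemma integral_sym_product_inner (f g : R -> R) (x : R) :
  measurable_fun setT f -> measurable_fun setT g ->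
  (forall x, 0 <= f x)%R -> (forall x, 0 <= g x)%R ->
  \int[mu]_y (f x * g y + f y * g x)%:E =
  (f x)%:E * (\int[mu]_y (g y)%:E) + (g x)%:E * (\int[mu]_y (f y)%:E).
Proof.
move=> /measurable_EFinP mf /measurable_EFinP mg f0 g0.
under eq_integral do rewrite EFinD !EFinM.
rewrite ge0_integralD//.
- congr (_ + _).
    by rewrite ge0_integralZl ?lee_fin// => y _; rewrite lee_fin.
  by rewrite ge0_integralZr ?lee_fin 1?muleC// => y _; rewrite lee_fin.
- by move=> y _; rewrite mule_ge0// lee_fin.
- exact: emeasurable_funM.
- by move=> y _; rewrite mule_ge0// lee_fin.
- exact: emeasurable_funM.
Qed.

(** Both orderings of the pair [(x, y)] are integrated at once, so that a
    pointwise bound on the symmetrized integrand suffices for a bound on a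
    product of two integrals. *)
Lemma integral_sym_product (f g : R -> R) :
  measurable_fun setT f -> measurable_fun setT g ->
  (forall x, 0 <= f x)%R -> (forall x, 0 <= g x)%R ->
  \int[mu]_x \int[mu]_y (f x * g y + f y * g x)%:E =
  (\int[mu]_x (f x)%:E) * (\int[mu]_x (g x)%:E) +
  (\int[mu]_x (f x)%:E) * (\int[mu]_x (g x)%:E).
Proof.
move=> mf mg f0 g0.
have /measurable_EFinP mEf := mf; have /measurable_EFinP mEg := mg.
under eq_integral do rewrite integral_sym_product_inner//.
set F := \int[mu]_x (f x)%:E; set G := \int[mu]_x (g x)%:E.
have F0 : 0 <= F by apply: integral_ge0 => x _; rewrite lee_fin.
have G0 : 0 <= G by apply: integral_ge0 => x _; rewrite lee_fin.
rewrite ge0_integralD//.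
- congr (_ + _).
    by rewrite ge0_integralZr// => y _; rewrite lee_fin.
  by rewrite ge0_integralZr 1?muleC// => y _; rewrite lee_fin.
- by move=> y _; rewrite mule_ge0// lee_fin.
- exact: emeasurable_funM.
- by move=> y _; rewrite mule_ge0// lee_fin.
- exact: emeasurable_funM.
Qed.

Lemma lee_double (x y : \bar R) : 0 <= x -> 0 <= y -> x + x <= y + y -> x <= y.
Proof.
move: x y => [x| |] [y| |] //=; rewrite ?lee_fin ?leey// => x0 y0.
by rewrite -!mulr2n ler_pMn2r.
Qed.

(** The integral form of the Ahlswede-Daykin inequality.  For [x <= y] put
    [A = f1 x * f2 y], [B = f1 y * f2 x], [C = f3 x * f4 y], [D = f3 y * f4 x].  The
    hypothesis at [(x, y)] and [(y, x)] bounds [A] and [B] by [C], and at [(x, x)]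
    and [(y, y)] it bounds [A * B] by [C * D]; hence [A + B <= C + D], which is
    integrated over all pairs. *)
Lemma four_functions (f1 f2 f3 f4 : R -> R) :
  measurable_fun setT f1 -> measurable_fun setT f2 ->
  measurable_fun setT f3 -> measurable_fun setT f4 ->
  (forall x, 0 <= f1 x)%R -> (forall x, 0 <= f2 x)%R ->
  (forall x, 0 <= f3 x)%R -> (forall x, 0 <= f4 x)%R ->
  (forall x y, f1 x * f2 y <= f3 (Num.min x y) * f4 (Num.max x y))%R ->
  (\int[mu]_x (f1 x)%:E) * (\int[mu]_x (f2 x)%:E) <=
  (\int[mu]_x (f3 x)%:E) * (\int[mu]_x (f4 x)%:E).
Proof.
move=> m1 m2 m3 m4 p1 p2 p3 p4 H.
apply: lee_double.
- by apply: mule_ge0; apply: integral_ge0 => x _; rewrite lee_fin.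
- by apply: mule_ge0; apply: integral_ge0 => x _; rewrite lee_fin.
rewrite -!integral_sym_product//.
have mouter (f g : R -> R) : measurable_fun setT f -> measurable_fun setT g ->
    (forall x, 0 <= f x)%R -> (forall x, 0 <= g x)%R ->
    measurable_fun [set: R] (fun x => \int[mu]_y (f x * g y + f y * g x)%:E).
  move=> mf mg f0 g0.
  have /measurable_EFinP mEf := mf; have /measurable_EFinP mEg := mg.
  under eq_fun do rewrite integral_sym_product_inner//.
  by apply: emeasurable_funD; exact: emeasurable_funM.
have minner (f g : R -> R) x : measurable_fun setT f -> measurable_fun setT g ->
    measurable_fun [set: R] (fun y => (f x * g y + f y * g x)%:E).
  move=> mf mg; apply/measurable_EFinP.
  by apply: measurable_funD; exact: measurable_funM.
(* The symmetrized integrands are invariant under exchange of [x] and [y]. *)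
have pw x y : (f1 x * f2 y + f1 y * f2 x <= f3 x * f4 y + f3 y * f4 x)%R.
  wlog xy : x y / (x <= y)%R.
    move=> wl; case: (leP x y) => [/wl//|/ltW/wl].
    by rewrite addrC [leRHS]addrC.
  have Hxy := H x y; have Hyx := H y x.
  have Hxx := H x x; have Hyy := H y y.
  rewrite !(min_l xy) !(max_r xy) in Hxy.
  rewrite !(min_r xy) !(max_l xy) in Hyx.
  rewrite minxx maxxx in Hxx; rewrite minxx maxxx in Hyy.
  apply: addr_le_of_mulr_le => //; try exact: mulr_ge0.
  have -> : (f1 x * f2 y * (f1 y * f2 x) = (f1 x * f2 x) * (f1 y * f2 y))%R by ring.
  have -> : (f3 x * f4 y * (f3 y * f4 x) = (f3 x * f4 x) * (f3 y * f4 y))%R by ring.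
  by apply: ler_pM => //; exact: mulr_ge0.
apply: ge0_le_integral => //.
- move=> x _; apply: integral_ge0 => y _.
  by rewrite lee_fin addr_ge0// mulr_ge0.
- exact: mouter.
- exact: mouter.
- move=> x _; apply: ge0_le_integral => //.
  + by move=> y _; rewrite lee_fin addr_ge0// mulr_ge0.
  + exact: minner.
  + exact: minner.
  + by move=> y _; rewrite lee_fin.
Qed.

End four_functions.

(** * Random walks killed outside a moving region *)

Section killed_walk.
Context {R : realType}.
Variables (mu : {sigma_finite_measure set (measurableTypeR R) -> \bar R})
  (w : R -> R -> R).

(** The expectation of [f] at time [n] for the walk started at the argument,
    with transition density [w] and killed when its position at time [k + 1] is
    outside [J k].  The recursion peels off the first step, which is what the
    four functions inequality needs. *)
Fixpoint killed_op (J : nat -> set R) (f : R -> R) (n : nat) : R -> R :=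
  if n is m.+1 then fun x =>
    fine (\int[mu]_y (\1_(J 0%N) y * w x y *
                       killed_op (fun k => J k.+1) f m y)%:E)%E
  else f.

Hypothesis w_ge0 : forall x y, 0 <= w x y.
Hypothesis measurable_w : measurable_fun setT (fun p : R * R => w p.1 p.2).
Hypothesis integral_w : forall x, (\int[mu]_y (w x y)%:E = 1)%E.

Definition admissible (f : R -> R) :=
  measurable_fun setT f /\ forall x, 0 <= f x <= 1.

Lemma measurable_kernel_row x : measurable_fun setT (w x).
Proof. exact: (measurableT_comp measurable_w (pair1_measurable x)). Qed.

Lemma measurable_step (A : set R) f x : measurable A -> measurable_fun setT f ->
  measurable_fun setT (fun y => \1_A y * w x y * f y).
Proof.
move=> mA mf; apply: measurable_funM => //; apply: measurable_funM.
  exact: measurable_indic.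
exact: measurable_kernel_row.
Qed.

Lemma step_bounds (A : set R) f x : measurable A -> admissible f ->
  (0 <= \int[mu]_y (\1_A y * w x y * f y)%:E <= 1)%E.
Proof.
move=> mA [mf f01]; apply/andP; split.
  apply: integral_ge0 => y _; rewrite lee_fin !mulr_ge0//.
  by have /andP[] := f01 y.
rewrite -(integral_w x); apply: ge0_le_integral => //.
- move=> y _; rewrite lee_fin !mulr_ge0//.
  by have /andP[] := f01 y.
- by apply/measurable_EFinP; exact: measurable_step.
- by apply/measurable_EFinP; exact: measurable_kernel_row.
- move=> y _; rewrite lee_fin.
  have /andP[f0 f1] := f01 y.
  have i1 : \1_A y <= 1 :> R by rewrite indicE; case: (_ \in _).
  have := ler_piMl (w_ge0 x y) i1; apply: le_trans.
  by apply: ler_piMr => //; exact: mulr_ge0.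
Qed.

Lemma step_fin_num (A : set R) f x : measurable A -> admissible f ->
  (\int[mu]_y (\1_A y * w x y * f y)%:E)%E \is a fin_num.
Proof.
move=> mA af; have /andP[h0 h1] := step_bounds x mA af.
by rewrite ge0_fin_numE//; exact: le_lt_trans h1 (ltry _).
Qed.

Lemma measurable_step_integral (A : set R) f : measurable A -> admissible f ->
  measurable_fun setT (fun x => fine (\int[mu]_y (\1_A y * w x y * f y)%:E)%E).
Proof.
move=> mA [mf f01]; apply/measurableT_comp => //.
pose h (p : R * R) := (\1_A p.2 * w p.1 p.2 * f p.2)%:E.
apply: (@measurable_fun_fubini_tonelli_F _ _
  (measurableTypeR R) (measurableTypeR R) R mu h).
  apply/measurable_EFinP; apply: measurable_funM; last exact: measurableT_comp.
  apply: measurable_funM => //.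
  exact: (measurableT_comp (measurable_indic _)).
move=> [x y]; rewrite /h lee_fin !mulr_ge0//=.
by have /andP[] := f01 y.
Qed.

Lemma admissible_killed_op J f n : (forall k, measurable (J k)) ->
  admissible f -> admissible (killed_op J f n).
Proof.
elim: n J => [//|n IH] J mJ af /=.
have afn := IH (fun k => J k.+1) (fun k => mJ k.+1) af.
split; first exact: measurable_step_integral.
move=> x; have /andP[h0 h1] := step_bounds x (mJ 0%N) afn.
by rewrite fine_ge0//= -lee_fin fineK// step_fin_num.
Qed.

Lemma killed_opS J f n x : (forall k, measurable (J k)) -> admissible f ->
  (killed_op J f n.+1 x)%:E = (\int[mu]_y (\1_(J 0%N) y * w x y *
                       killed_op (fun k => J k.+1) f n y)%:E)%E.
Proof.
move=> mJ af /=; rewrite fineK//; apply: step_fin_num => //.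
by apply: admissible_killed_op.
Qed.

(** Survival probabilities inherit the four functions hypothesis from the
    kernel: in one step the integrands [1_(J 0) * w x * u] satisfy it, because the
    indicators do, [w] is totally positive, and [u] does by induction. *)
Lemma killed_op_four (J1 J2 J3 J4 : nat -> set R) f1 f2 f3 f4 :
  (forall k, measurable (J1 k)) -> (forall k, measurable (J2 k)) ->
  (forall k, measurable (J3 k)) -> (forall k, measurable (J4 k)) ->
  admissible f1 -> admissible f2 -> admissible f3 -> admissible f4 ->
  (forall x1 x2 y1 y2, w x1 y1 * w x2 y2 <=
    w (Num.min x1 x2) (Num.min y1 y2) * w (Num.max x1 x2) (Num.max y1 y2)) ->
  (forall k y1 y2, J1 k y1 -> J2 k y2 ->
    J3 k (Num.min y1 y2) /\ J4 k (Num.max y1 y2)) ->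
  (forall y1 y2, f1 y1 * f2 y2 <= f3 (Num.min y1 y2) * f4 (Num.max y1 y2)) ->
  forall n x1 x2, killed_op J1 f1 n x1 * killed_op J2 f2 n x2 <=
    killed_op J3 f3 n (Num.min x1 x2) * killed_op J4 f4 n (Num.max x1 x2).
Proof.
move=> m1 m2 m3 m4 a1 a2 a3 a4 Hw HJ Hf n.
elim: n J1 J2 J3 J4 m1 m2 m3 m4 HJ => [//|n IH] J1 J2 J3 J4 m1 m2 m3 m4 HJ x1 x2.
rewrite -lee_fin [leLHS]EFinM [leRHS]EFinM !killed_opS//.
have b1 := admissible_killed_op n (fun k => m1 k.+1) a1.
have b2 := admissible_killed_op n (fun k => m2 k.+1) a2.
have b3 := admissible_killed_op n (fun k => m3 k.+1) a3.
have b4 := admissible_killed_op n (fun k => m4 k.+1) a4.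
have ge0 A g x y : admissible g -> 0 <= \1_A y * w x y * g y.
  by move=> [_ /(_ y)/andP[g0 _]]; rewrite !mulr_ge0.
apply: four_functions.
- by apply: measurable_step => //; case: b1.
- by apply: measurable_step => //; case: b2.
- by apply: measurable_step => //; case: b3.
- by apply: measurable_step => //; case: b4.
- by move=> y; exact: ge0.
- by move=> y; exact: ge0.
- by move=> y; exact: ge0.
- by move=> y; exact: ge0.
move=> y1 y2.
have := IH _ _ _ _ (fun k => m1 k.+1) (fun k => m2 k.+1) (fun k => m3 k.+1)
  (fun k => m4 k.+1) (fun k => HJ k.+1) y1 y2.
set u1 := killed_op _ _ _ _; set u2 := killed_op _ _ _ _.
set u3 := killed_op _ _ _ _; set u4 := killed_op _ _ _ _ => Hu.
have u10 : 0 <= u1 by case: b1 => _ /(_ y1)/andP[].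
have u20 : 0 <= u2 by case: b2 => _ /(_ y2)/andP[].
have [y1J1|y1J1] := boolP (y1 \in J1 0%N); last first.
  rewrite indicE (negbTE y1J1) !mul0r mulr_ge0//; exact: ge0.
have [y2J2|y2J2] := boolP (y2 \in J2 0%N); last first.
  rewrite [\1_(J2 _) _]indicE (negbTE y2J2) !mul0r mulr0 mulr_ge0//; exact: ge0.
rewrite !inE in y1J1 y2J2; have [y3 y4] := HJ _ _ _ y1J1 y2J2.
rewrite !indicE !mem_set// !mul1r.
have -> : w x1 y1 * u1 * (w x2 y2 * u2) = (w x1 y1 * w x2 y2) * (u1 * u2) by ring.
set a := w (Num.min _ _) _; set b := w (Num.max _ _) _.
have -> : a * u3 * (b * u4) = (a * b) * (u3 * u4) by ring.
by apply: ler_pM => //; exact: mulr_ge0.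
Qed.

(** The Markov property at time [m]. *)
Lemma killed_op_semigroup J f m n x :
  killed_op J f (m + n) x =
  killed_op J (killed_op (fun k => J (m + k)%N) f n) m x.
Proof. by elim: m J x => [//|m IH] J x /=; under eq_integral do rewrite IH. Qed.

Lemma killed_op_scale_le J f g (c : R) : (forall k, measurable (J k)) ->
  admissible f -> admissible g -> 0 <= c -> (forall x, c * f x <= g x) ->
  forall n x, c * killed_op J f n x <= killed_op J g n x.
Proof.
move=> mJ af ag c0 fg n; elim: n J mJ => [//|n IH] J mJ x.
have [mf f01] := admissible_killed_op n (fun k => mJ k.+1) af.
have [mg g01] := admissible_killed_op n (fun k => mJ k.+1) ag.
have ge0 y : (0 <= (\1_(J 0%N) y * w x y * killed_op (fun k => J k.+1) f n y)%:E)%E.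
  by rewrite lee_fin !mulr_ge0//; have /andP[] := f01 y.
rewrite -lee_fin EFinM !killed_opS// -ge0_integralZl ?lee_fin//; last first.
  by apply/measurable_EFinP; exact: measurable_step.
apply: ge0_le_integral => //.
- by move=> y _; rewrite mule_ge0.
- apply: measurable_funeM; by apply/measurable_EFinP; exact: measurable_step.
- by apply/measurable_EFinP; exact: measurable_step.
- move=> y _; rewrite -EFinM lee_fin mulrCA ler_wpM2l ?mulr_ge0//.
  exact: IH.
Qed.

Lemma killed_op_unconstrained n x : killed_op (fun=> setT) (cst 1) n x = 1.
Proof.
elim: n x => [//|n IH] x /=.
under eq_integral do rewrite IH indicT mul1r mulr1.
by rewrite integral_w.
Qed.

End killed_walk.

(** * The Gaussian transition density *)

Section translation.
Context {R : realType}.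
Local Notation leb := (@lebesgue_measure R).
Local Open Scope ereal_scope.

Lemma measurable_translation (x : R) :
  measurable_fun [set: measurableTypeR R] (fun z => x + z : measurableTypeR R)%R.
Proof. exact: measurable_funD. Qed.

Lemma lebesgue_measure_translation (x : R) (A : set R) : measurable A ->
  leb ((fun z => x + z)%R @^-1` A) = leb A.
Proof.
move=> mA; apply/esym.
have mx := measurable_translation x.
apply: (@lebesgue_measure_unique R
  (pushforward leb (fun z => x + z : measurableTypeR R)%R)) => // _ [[a b]] _ <-.
rewrite -[RHS]/(leb ((fun z => x + z)%R @^-1` `]a, b])).
have -> : (fun z : R => x + z)%R @^-1` `]a, b] = `](a - x)%R, (b - x)%R]%classic.
  by apply/seteqP; split=> z /=; rewrite !in_itv/= ltrBlDl lerBrDl.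
rewrite !lebesgue_measure_itv/= !lte_fin ltrD2r.
by case: ifP => // _; rewrite -!EFinB; congr (_%:E); ring.
Qed.

Lemma ge0_integral_translation (x : R) (f : R -> \bar R) :
  measurable_fun setT f -> (forall y, 0 <= f y) ->
  \int[leb]_z f (x + z)%R = \int[leb]_y f y.
Proof.
move=> mf f0.
have mp := measurable_translation x.
transitivity (\int[pushforward leb (fun z => x + z : measurableTypeR R)%R]_y f y).
  by rewrite (ge0_integral_pushforward mp).
apply: eq_measure_integral => A mA _; exact: lebesgue_measure_translation.
Qed.

Import HBNNSimple.

(** The usual approximation: the identity holds for indicators by
    hypothesis, for simple functions by linearity, and passes to increasing
    limits. *)
Lemma ge0_integral_density (g : R -> R)
  (nu : {measure set (measurableTypeR R) -> \bar R}) (f : R -> \bar R) :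
  measurable_fun setT g -> (forall y, 0 <= g y)%R ->
  (forall A : set R, measurable A -> nu A = \int[leb]_(y in A) (g y)%:E) ->
  measurable_fun setT f -> (forall y, 0 <= f y) ->
  \int[nu]_y f y = \int[leb]_y (f y * (g y)%:E).
Proof.
move=> mg g0 nuE mf f0.
have mEg : measurable_fun setT (fun y : measurableTypeR R => (g y)%:E).
  by apply/measurable_EFinP.
pose h := @nnsfun_approx _ (measurableTypeR R) R setT measurableT f mf.
have cvh x : (fun n => (h n x)%:E) @ \oo --> f x.
  by apply: cvg_nnsfun_approx.
have ndh x m n : (m <= n)%N -> (h m x <= h n x)%R.
  by move=> mn; exact/lefP/nd_nnsfun_approx.
transitivity (limn (fun n => \int[nu]_y (h n y)%:E)).
  rewrite -monotone_convergence//.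
  - by apply: eq_integral => y _; apply/esym/cvg_lim.
  - by move=> n; apply/measurable_EFinP.
  - by move=> n x _; rewrite lee_fin.
  - by move=> x _ m n mn; rewrite lee_fin; exact: ndh.
transitivity (limn (fun n => \int[leb]_y ((h n y)%:E * (g y)%:E))); last first.
  rewrite -monotone_convergence//.
  - apply: eq_integral => y _; apply/cvg_lim => //.
    by apply: cvgeZr => //.
  - move=> n; apply: emeasurable_funM => //; exact/measurable_EFinP.
  - by move=> n x _; rewrite mule_ge0 ?lee_fin.
  - by move=> x _ m n mn; rewrite lee_wpmul2r// lee_fin//; exact: ndh.
congr (limn _); apply/funext => n.
under eq_integral do rewrite fimfunE -fsumEFin//.
rewrite ge0_integral_fsum//; last 2 first.
- by move=> r; exact/measurable_EFinP/measurable_funM.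
- by move=> r x _; rewrite EFinM nnfun_muleindic_ge0.
transitivity (\int[leb]_y (\sum_(r \in range (h n))
    ((r * \1_(h n @^-1` [set r]) y)%:E * (g y)%:E))); last first.
  apply: eq_integral => y _; rewrite fimfunE -fsumEFin// ge0_mule_fsuml//.
  by move=> r; exact: nnfun_muleindic_ge0.
rewrite ge0_integral_fsum//; last 2 first.
- move=> r; apply: emeasurable_funM => //; exact/measurable_EFinP/measurable_funM.
- by move=> r x _; rewrite mule_ge0 ?lee_fin//; exact: nnfun_muleindic_ge0.
apply: eq_fsbigr => r rh.
have r0 : (0 <= r)%R by move: rh; rewrite inE => -[z _ <-].
have mr : measurable (h n @^-1` [set r]) by [].
have i0 y : 0 <= (\1_(h n @^-1` [set r]) y)%:E :> \bar R by rewrite lee_fin.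
transitivity (r%:E * nu (h n @^-1` [set r])).
  under eq_integral do rewrite EFinM.
  rewrite ge0_integralZl//; last exact/measurable_EFinP.
  by rewrite integral_indic// setIT.
rewrite nuE// -ge0_integralZl//.
- rewrite integral_mkcond; apply: eq_integral => y _; rewrite patchE.
  change ((if y \in h n @^-1` [set r] then r%:E * (g y)%:E else 0) =
    (r * \1_(h n @^-1` [set r]) y)%R%:E * (g y)%:E).
  by rewrite indicE; case: ifP => _; rewrite ?mulr1 ?mulr0 ?mul0e.
- exact: measurable_funTS.
- by move=> y _; rewrite lee_fin.
Qed.

End translation.

Lemma normal_pdf_expE {R : realType} (m s x : R) : s != 0 ->
  normal_pdf m s x = normal_peak s * expR (- (x - m) ^+ 2 / (s ^+ 2 *+ 2)).
Proof. by move=> s0; rewrite normal_pdfE. Qed.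

Section gaussian_kernel.
Context {R : realType}.
Variables (m s : R).
Hypothesis s_neq0 : s != 0.
Local Notation leb := (@lebesgue_measure R).

Definition gauss_kernel (x y : R) : R := normal_pdf (x + m) s y.

Lemma gauss_kernelE x y : gauss_kernel x y =
  normal_peak s * expR (- (y - (x + m)) ^+ 2 / (s ^+ 2 *+ 2)).
Proof. exact: normal_pdf_expE. Qed.

(** A step of the walk has the law of a normal variable with mean [m]. *)
Lemma gauss_kernel_shift x y : gauss_kernel x (x + y) = normal_pdf m s y.
Proof.
rewrite gauss_kernelE normal_pdf_expE//.
by have -> : x + y - (x + m) = y - m by ring.
Qed.

Lemma gauss_kernel_ge0 x y : 0 <= gauss_kernel x y.
Proof. exact: normal_pdf_ge0. Qed.

Lemma measurable_gauss_kernel :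
  measurable_fun setT (fun p : R * R => gauss_kernel p.1 p.2).
Proof.
under eq_fun do rewrite gauss_kernelE.
apply: measurable_funM => //; apply: measurableT_comp => //.
apply: measurable_funM => //; apply: measurableT_comp => //.
apply: measurable_funX; apply: measurable_funB => //.
exact: measurable_funD.
Qed.

Lemma integral_gauss_kernel x : (\int[leb]_y (gauss_kernel x y)%:E = 1)%E.
Proof. exact: integral_normal_pdf. Qed.

(** Only pairs in opposite order need an argument: there the exponents
    differ by a positive multiple of [(x2 - x1) * (y1 - y2)]. *)
Lemma gauss_kernel_TP2 x1 x2 y1 y2 :
  gauss_kernel x1 y1 * gauss_kernel x2 y2 <=
  gauss_kernel (Num.min x1 x2) (Num.min y1 y2) *
  gauss_kernel (Num.max x1 x2) (Num.max y1 y2).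
Proof.
rewrite !gauss_kernelE.
have pk : 0 <= normal_peak s by exact: normal_peak_ge0.
have E (p a b : R) : p * expR a * (p * expR b) = p * p * expR (a + b).
  by rewrite expRD; ring.
rewrite !E; apply: ler_wpM2l; first exact: mulr_ge0.
rewrite ler_expR -!mulrDl; apply: ler_wpM2r.
  by rewrite invr_ge0 mulrn_wge0// sqr_ge0.
have [xx|/ltW xx] := leP x1 x2; have [yy|/ltW yy] := leP y1 y2.
- by [].
- rewrite -subr_ge0 [leRHS](_ : _ = 2 * ((x2 - x1) * (y1 - y2))); last by ring.
  by rewrite mulr_ge0// mulr_ge0// subr_ge0.
- rewrite -subr_ge0 [leRHS](_ : _ = 2 * ((x1 - x2) * (y2 - y1))); last by ring.
  by rewrite mulr_ge0// mulr_ge0// subr_ge0.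
- by rewrite addrC.
Qed.

Lemma ge0_integral_gauss_kernel x (f : R -> \bar R) :
  measurable_fun setT f -> (forall y, 0 <= f y)%E ->
  (\int[normal_prob m s]_z f (x + z)%R =
   \int[leb]_y (f y * (gauss_kernel x y)%:E))%E.
Proof.
move=> mf f0.
rewrite (ge0_integral_density (g := normal_pdf m s))//.
- rewrite -[RHS](ge0_integral_translation x).
  + by apply: eq_integral => y _; rewrite gauss_kernel_shift.
  + apply: emeasurable_funM => //; apply/measurable_EFinP.
    exact: measurable_normal_pdf.
  + by move=> y; rewrite mule_ge0// lee_fin gauss_kernel_ge0.
- exact: measurable_normal_pdf.
- by move=> y; exact: normal_pdf_ge0.
- exact: (measurableT_comp mf (measurable_translation x)).
Qed.

Lemma normal_prob_translation (A : set R) : measurable A ->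
  normal_prob 0 s ((fun z => z + m) @^-1` A) = normal_prob m s A.
Proof.
move=> mA; rewrite /normal_prob integral_mkcond [RHS]integral_mkcond.
rewrite -[RHS](ge0_integral_translation m).
- apply: eq_integral => y _; rewrite !patchE.
  have -> : (y \in (fun z => z + m) @^-1` A) = (m + y \in A).
    by apply/idP/idP; rewrite !inE/= addrC.
  case: ifP => // _; congr (_%:E).
  rewrite !normal_pdf_expE//.
  by have -> : m + y - m = y - 0 by ring.
- apply/(measurable_restrictT _ _).1 => //; apply/measurable_EFinP.
  by apply: measurable_funTS; exact: measurable_normal_pdf.
- move=> y; rewrite patchE; case: ifP => // _.
  by rewrite lee_fin normal_pdf_ge0.
Qed.

End gaussian_kernel.

(** The density is bounded below by a positive constant on [[c, c + 1]]. *)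
Lemma normal_prob_gt0 {R : realType} (m s c : R) : s != 0 ->
  (0 < normal_prob m s `[c, +oo[)%E.
Proof.
move=> s0.
have cc : c <= c + 1 by lra.
have [x0 _ x0min] := EVT_min cc
  (continuous_subspaceT (continuous_normal_pdf (m := m) s0)).
have px0 : 0 < normal_pdf m s x0.
  by rewrite normal_pdfE// mulr_gt0 ?normal_peak_gt0 ?expR_gt0.
rewrite /normal_prob.
have mpdf (A : set R) : measurable_fun A
    (fun x : measurableTypeR R => (normal_pdf m s x)%:E).
  by apply/measurable_EFinP; apply: measurable_funTS; exact: measurable_normal_pdf.
apply: (@lt_le_trans _ _
  (\int[lebesgue_measure]_(x in `[c, (c + 1)%R]) (normal_pdf m s x)%:E)%E);
  last first.
  apply: ge0_subset_integral => //.
  - exact: mpdf.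
  - by move=> x _; rewrite lee_fin normal_pdf_ge0.
  - by move=> x /=; rewrite !in_itv/= andbT => /andP[].
apply: (@lt_le_trans _ _
  (\int[lebesgue_measure]_(x in `[c, (c + 1)%R]) (normal_pdf m s x0)%:E)%E).
  rewrite integral_cst//= lebesgue_measure_itv/= lte_fin ltrDl ltr01.
  by rewrite -EFinD -EFinM lte_fin mulr_gt0//; lra.
apply: ge0_le_integral => //.
- by move=> x _; rewrite lee_fin ltW.
- exact: mpdf.

Qed.

(** * Integration against an independent variable *)

Section law.
Context d (T : measurableType d) {R : realType}.
Variables (Q : {finite_measure set T -> \bar R}) (Y : T -> R).

(** The measurability proof is an argument so that the finite measure
    structure on the law can be inferred. *)
Definition law of measurable_fun setT Y : set (measurableTypeR R) -> \bar R :=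
  fun A => Q (Y @^-1` A).

Variable mY : measurable_fun setT Y.
Local Notation lawY := (law mY).

Let law0 : lawY set0 = 0%E.
Proof. by rewrite /law preimage_set0 measure0. Qed.

Let law_ge0 A : (0 <= lawY A)%E.
Proof. exact: measure_ge0. Qed.

Let law_sigma_additive : semi_sigma_additive lawY.
Proof.
exact: (@measure_semi_sigma_additive _ _ _
  (pushforward Q (Y : T -> measurableTypeR R))).
Qed.

HB.instance Definition _ := isMeasure.Build _ _ _ lawY law0 law_ge0
  law_sigma_additive.

Let law_finite : fin_num_fun lawY.
Proof.
move=> A mA; apply: fin_num_measure.
by rewrite -[X in measurable X]setTI; exact: mY.
Qed.

HB.instance Definition _ := Measure_isFinite.Build _ _ _ lawY law_finite.

Lemma ge0_integral_law (f : R -> \bar R) : measurable_fun setT f ->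
  (forall y, 0 <= f y)%E -> (\int[lawY]_y f y = \int[Q]_w f (Y w))%E.
Proof.
move=> mf f0.
rewrite -[RHS](@ge0_integral_pushforward _ _ T (measurableTypeR R) R Y mY Q setT f)//.
Qed.

End law.

Section independence.
Context d (T : measurableType d) {R : realType}.
Local Open Scope ereal_scope.

Lemma ge0_integral_mrestr (Q : {finite_measure set T -> \bar R}) (A : set T)
    (mA : measurable A) (f : T -> \bar R) :
  measurable_fun setT f -> (forall w, 0 <= f w) ->
  \int[mrestr Q mA]_w f w = \int[Q]_w ((\1_A w)%:E * f w).
Proof.
move=> mf f0.
rewrite -(setUv A) ge0_integral_setU//=.
- rewrite [X in _ + X](_ : _ = 0) ?adde0; last first.
    apply: null_set_integral => //.
    - exact: measurableC.
    - exact: measurable_funTS.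
    - by rewrite /= /mrestr setICl measure0.
  rewrite (@eq_measure_integral _ _ _ _ Q); last first.
    by move=> B mB BA; rewrite /= /mrestr setIidl.
  rewrite setUv integral_mkcond; apply: eq_integral => w _.
  by rewrite patchE indicE; case: ifP => _; rewrite ?mul1e ?mul0e.
- exact: measurableC.
- by apply: measurable_funTS.
- exact/disj_setPCl.
Qed.

(** The joint law of [(Y, Z)] agrees with the product measure on rectangles,
    hence everywhere, and Tonelli applies.  [Q] is an arbitrary finite measure
    because it will be the restriction of a probability to an event of the
    past. *)
Lemma ge0_integral_indep_pair (Q : {finite_measure set T -> \bar R})
    (Y Z : T -> R) (nu : probability (measurableTypeR R) R) :
  measurable_fun setT Y -> measurable_fun setT Z ->
  (forall D E : set R, measurable D -> measurable E ->
    Q (Y @^-1` D `&` Z @^-1` E) = Q (Y @^-1` D) * nu E) ->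
  forall h : R * R -> \bar R, measurable_fun setT h -> (forall p, 0 <= h p) ->
  \int[Q]_w h (Y w, Z w) = \int[Q]_w \int[nu]_z h (Y w, z).
Proof.
move=> mY mZ QYZ h mh h0.
pose YZ w : measurableTypeR R * measurableTypeR R := (Y w, Z w).
have mYZ : measurable_fun setT YZ by apply/measurable_fun_pairP.
transitivity (\int[pushforward Q YZ]_p h p).
  by rewrite (ge0_integral_pushforward mYZ).
transitivity (\int[law Q mY \x nu]_p h p).
  apply: eq_measure_integral => A mA _.
  apply/esym; apply: product_measure_unique => //.
rewrite fubini_tonelli1//.
rewrite (ge0_integral_law Q mY)//.
  by apply: measurable_fun_fubini_tonelli_F.
by move=> y; apply: integral_ge0.
Qed.

End independence.

(** * From independent increments to killed walks *)

Section walk.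
Context {R : realType}.

(** The increments are consumed in the order in which [killed_op] integrates
    them, so that the two recursions match step by step. *)
Fixpoint walk_in (J : nat -> set R) (D : set R) (n : nat) (y : R)
    (x : nat -> R) : Prop :=
  if n is m.+1 then
    J 0%N (y + x 0%N) /\
    walk_in (fun k => J k.+1) D m (y + x 0%N) (fun k => x k.+1)
  else D y.

Context d (T : measurableType d).
Variable nu : probability (measurableTypeR R) R.

(** The increments [X 0, ..., X n.-1] are independent of each other and of
    the current position [Y] under [Q], with common law [nu].  Conditioning on
    past events is encoded in [Q], which is not normalized. *)
Definition independent_future (Q : set T -> \bar R) (Y : T -> R)
    (X : nat -> T -> R) (n : nat) :=
  forall (D0 : set R) (D : nat -> set R), measurable D0 ->
    (forall i, measurable (D i)) ->
    Q (Y @^-1` D0 `&` [set w | forall i, (i < n)%N -> D i (X i w)]) =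
    (Q (Y @^-1` D0) * \prod_(i < n) nu (D i))%E.

Lemma measurable_all_in (D : nat -> set R) n (X : nat -> T -> R) :
  (forall i, measurable (D i)) -> (forall i, measurable_fun setT (X i)) ->
  measurable [set w | forall i, (i < n)%N -> D i (X i w)].
Proof.
move=> mD mX.
have -> : [set w | forall i, (i < n)%N -> D i (X i w)] =
    \bigcap_(i in [set i | (i < n)%N]) (X i @^-1` D i).
  by apply/seteqP; split => w /= H i; exact: H.
apply: bigcap_measurableType => i _.
by rewrite -[X in measurable X]setTI; exact: mX.
Qed.

Section one_step.
Variables (Q : {finite_measure set T -> \bar R}) (Y : T -> R)
  (X : nat -> T -> R) (n : nat).
Hypotheses (mY : measurable_fun setT Y)
  (mX : forall i, measurable_fun setT (X i))
  (indX : independent_future Q Y X n.+1).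

Lemma independent_future_head (D0 E0 : set R) (D : nat -> set R) :
  measurable D0 -> measurable E0 -> (forall i, measurable (D i)) ->
  Q (Y @^-1` D0 `&` X 0%N @^-1` E0 `&`
     [set w | forall i, (i < n)%N -> D i (X i.+1 w)]) =
  (Q (Y @^-1` D0) * nu E0 * \prod_(i < n) nu (D i))%E.
Proof.
move=> mD0 mE0 mD.
have := indX mD0 (D := fun i => if i is j.+1 then D j else E0).
rewrite big_ord_recl/= muleA => <-; last by case.
congr (Q _); rewrite -setIA; congr (_ `&` _).
apply/seteqP; split => [w /= [wE0 wD] [|i]//|w /= wD]; first exact: wD.
by split => [|i i_n]; [exact: (wD 0%N)|exact: (wD i.+1)].
Qed.

Lemma independent_future_first (D0 E0 : set R) :
  measurable D0 -> measurable E0 ->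
  Q (Y @^-1` D0 `&` X 0%N @^-1` E0) = (Q (Y @^-1` D0) * nu E0)%E.
Proof.
move=> mD0 mE0.
have := independent_future_head mD0 mE0 (D := fun=> setT) (fun=> measurableT).
rewrite big1 ?mule1 => [<-|i _]; last exact: probability_setT.
by congr (Q _); apply/seteqP; split => w /= => [?|[]//]; split.
Qed.

Lemma measurable_next : measurable_fun setT (fun w => Y w + X 0%N w).
Proof. exact: measurable_funD. Qed.

Lemma measurable_next_preimage (J0 : set R) : measurable J0 ->
  measurable [set w | J0 (Y w + X 0%N w)].
Proof.
by move=> mJ0; rewrite -[X in measurable X]setTI; exact: measurable_next.
Qed.

(** After one step, restricting [Q] to the survival event and moving [Y] to
    [Y + X 0] preserves the independence of the remaining increments.  Both sides
    of the product rule are integrals of the same function of [Y] and [X 0], one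
    under [Q] restricted to the event [E] on the later increments, the other
    under [Q] multiplied by the probability of [E]. *)
Lemma independent_future_next (J0 : set R) (mJ0 : measurable J0) :
  independent_future (mrestr Q (measurable_next_preimage mJ0))
    (fun w => Y w + X 0%N w) (fun i => X i.+1) n.
Proof.
move=> D0 D mD0 mD; rewrite /mrestr.
set E := [set w | forall i, _ -> _].
have mE : measurable E by exact: measurable_all_in.
set c := (\prod_(i < n) nu (D i))%E.
have c0 : (0 <= c)%E by apply: prode_ge0 => i _.
have cfin : c \is a fin_num.
  rewrite /c; elim/big_ind: _ => // [x y xf yf|i _]; first by rewrite fin_numM.
  by apply: (fin_num_measure nu); exact: mD.
pose G := J0 `&` D0.
have mG : measurable G by exact: measurableI.
pose h (p : R * R) : \bar R := (\1_G (p.1 + p.2))%:E.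
have h0 p : (0 <= h p)%E by rewrite lee_fin.
have mh : measurable_fun setT h.
  apply/measurable_EFinP; apply: (measurableT_comp (measurable_indic _)) => //.
  exact: measurable_funD.
have indh (Q' : {finite_measure set T -> \bar R}) :
    (\int[Q']_w h (Y w, X 0%N w) = Q' [set w | G (Y w + X 0%N w)%R])%E.
  by rewrite integral_indic ?setIT//; exact: measurable_next_preimage.
(* Move the constraint on the later increments into the measure. *)
transitivity (mrestr Q mE [set w | G (Y w + X 0%N w)]).
  rewrite /mrestr; congr (Q _); apply/seteqP; split => w /=.
    by move=> [[? ?] ?].
  by move=> [[? ?] ?].
transitivity (c * Q [set w | G (Y w + X 0%N w)%R])%E; last first.
  rewrite muleC; congr (Q _ * _)%E; apply/seteqP; split => w /=.
    by move=> [? ?].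
  by move=> [? ?].
rewrite -!indh.
rewrite (ge0_integral_indep_pair (nu := nu) mY (mX 0%N))//; last first.
  move=> D1 E1 mD1 mE1; rewrite /= /mrestr.
  rewrite independent_future_head// muleAC; congr (_ * _)%E.
  have := independent_future_head mD1 measurableT mD.
  by rewrite preimage_setT setIT probability_setT mule1.
rewrite (ge0_integral_indep_pair (nu := nu) mY (mX 0%N))//; last first.
  by move=> D1 E1; exact: independent_future_first.
pose g y := (\int[nu]_z h (y, z))%E.
have mg : measurable_fun [set: measurableTypeR R] g.
  exact: (@measurable_fun_fubini_tonelli_F _ _
    (measurableTypeR R) (measurableTypeR R) R nu h).
have g0 y : (0 <= g y)%E by apply: integral_ge0.
rewrite -[LHS](ge0_integral_law (mrestr Q mE) mY mg g0).
rewrite -[X in (_ * X)%E](ge0_integral_law Q mY mg g0).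
pose c' := NngNum (fine_ge0 c0).
have cE : c = c'%:num%:E by rewrite /= fineK.
rewrite cE -ge0_integral_mscale//.
apply: eq_measure_integral => A mA _.
change (Q (Y @^-1` A `&` E) = c'%:num%:E * Q (Y @^-1` A))%E; rewrite -cE.
have := independent_future_head mA measurableT mD.
by rewrite preimage_setT setIT probability_setT mule1 muleC.
Qed.

End one_step.

Variable mu : {sigma_finite_measure set (measurableTypeR R) -> \bar R}.
Variable w : R -> R -> R.
Hypothesis w_ge0 : forall x y, 0 <= w x y.
Hypothesis measurable_w : measurable_fun setT (fun p : R * R => w p.1 p.2).
Hypothesis integral_w : forall x, (\int[mu]_y (w x y)%:E = 1)%E.
Hypothesis nu_w : forall x (f : R -> \bar R), measurable_fun setT f ->
  (forall y, 0 <= f y)%E ->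
  (\int[nu]_z f (x + z)%R = \int[mu]_y (f y * (w x y)%:E))%E.

Lemma admissible_indic (D : set R) : measurable D -> admissible (\1_D : R -> R).
Proof.
move=> mD; split; first exact: measurable_indic.
by move=> x; rewrite indicE; case: (_ \in _); rewrite ?lexx ?ler01.
Qed.

(** Induction on the number of steps: the first increment is integrated out
    by Tonelli, and the restriction of [Q] to the survival event takes the place
    of [Q]. *)
Lemma walk_in_law (J : nat -> set R) (D : set R) n
    (Q : {finite_measure set T -> \bar R}) (Y : T -> R) (X : nat -> T -> R) :
  (forall k, measurable (J k)) -> measurable D ->
  measurable_fun setT Y -> (forall i, measurable_fun setT (X i)) ->
  independent_future Q Y X n ->
  Q [set t | walk_in J D n (Y t) (fun i => X i t)] =
  (\int[Q]_t (killed_op mu w J \1_D n (Y t))%:E)%E.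
Proof.
move=> + mD; elim: n J Q Y X => [|n IH] J Q Y X mJ mY mX indX.
  rewrite [RHS](_ : _ = \int[Q]_t (\1_(Y @^-1` D) t)%:E)%E; last first.
    by apply: eq_integral => t _; rewrite /= !indicE.
  rewrite integral_indic ?setIT//.
  by rewrite -[X in measurable X]setTI; exact: mY.
have aD := admissible_indic mD.
set A := measurable_next_preimage mY mX (mJ 0%N).
pose u := killed_op mu w (fun k => J k.+1) \1_D n.
have [u_meas u01] : admissible u by exact: admissible_killed_op.
have mu' : measurable_fun setT (fun y => (u y)%:E) by exact/measurable_EFinP.
have u0 y : (0 <= (u y)%:E)%E by rewrite lee_fin; have /andP[] := u01 y.
transitivity (mrestr Q A
    [set t | walk_in (fun k => J k.+1) D n (Y t + X 0%N t) (fun i => X i.+1 t)]).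
  by rewrite /mrestr setIC.
rewrite IH//; last 2 first.
- exact: measurable_next.
- exact: independent_future_next.
rewrite ge0_integral_mrestr//; last first.
  by apply: (measurableT_comp mu'); exact: measurable_next.
pose f y := (\1_(J 0%N) y * u y)%:E.
have mf : measurable_fun setT f.
  by apply/measurable_EFinP; apply: measurable_funM => //; exact: measurable_indic.
have f0 y : (0 <= f y)%E.
  by rewrite lee_fin mulr_ge0//; have /andP[] := u01 y.
pose h (p : R * R) := f (p.1 + p.2).
rewrite [LHS](_ : _ = \int[Q]_t h (Y t, X 0%N t))%E; last first.
  by apply: eq_integral => t _; rewrite -EFinM.
rewrite (ge0_integral_indep_pair (nu := nu) mY (mX 0%N))//.
- apply: eq_integral => t _; rewrite /h/= nu_w// killed_opS//.
  apply: eq_integral => y _; rewrite -EFinM; congr (_%:E).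
  by rewrite mulrAC.
- by move=> D1 E1; apply: (independent_future_first indX).
- by apply: (measurableT_comp mf); exact: measurable_funD.
- by move=> p; exact: f0.
Qed.

End walk.

(** * Brownian motion with drift on a grid *)

Lemma walk_in_path {R : realType} (J : nat -> set R) (D : set R) n (y : R)
    (x p : nat -> R) :
  (forall i, x i = p i.+1 - p i) ->
  walk_in J D n y x <->
  (forall k, (k < n)%N -> J k (y + (p k.+1 - p 0%N))) /\ D (y + (p n - p 0%N)).
Proof.
elim: n J y x p => [|n IH] J y x p xp /=.
  by rewrite subrr addr0; split => [|[]].
rewrite (IH _ _ _ (fun i => p i.+1))//.
have E k : y + x 0%N + (p k - p 1%N) = y + (p k - p 0%N).
  by rewrite xp; ring.
rewrite E; split => [[J0 [JS Dn]]|[JS Dn]].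
  split => // -[|k] kn; first by rewrite -xp.
  by rewrite -E; exact: JS.
split; first by rewrite xp; exact: JS.
by split => // k kn; rewrite E; exact: JS.
Qed.

Section brownian_grid.
Context {R : realType} d (T : measurableType d) (P : probability T R)
  (B : R -> {RV P >-> R}) (HB : standard_brownian_motion B) (mu : R).
Local Notation leb := (@lebesgue_measure R).

Definition displacement (z : R) (w : T) : R := B z w - B 0 w + mu * z.

Definition grid_op (h : R) := killed_op leb (gauss_kernel (mu * h) (Num.sqrt h)).

Lemma measurable_displacement z : measurable_fun setT (displacement z).
Proof. by apply: measurable_funD => //; exact: measurable_funB. Qed.

Section fixed_mesh.
Variable h : R.
Hypothesis h_gt0 : 0 < h.

Let sh_neq0 : Num.sqrt h != 0.
Proof. by rewrite gt_eqF// sqrtr_gt0. Qed.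

Let increment (i : nat) (w : T) : R :=
  B (i.+1%:R * h) w - B (i%:R * h) w + mu * h.

Lemma independent_future_increment (x : R) (n : nat) :
  independent_future (normal_prob (mu * h) (Num.sqrt h)) P (cst x) increment n.
Proof.
move=> D0 D mD0 mD.
rewrite preimage_cst; case: ifPn => xD0; last by rewrite set0I measure0 mul0e.
rewrite setTI probability_setT mul1e.
pose s i := i%:R * h.
have s0 : 0 <= s 0%N by rewrite /s mul0r.
have sS i : s i.+1 - s i = h by rewrite /s -mulrBl -natrB// subSnn mul1r.
have slt i : s i < s i.+1 by rewrite -subr_gt0 sS.
have sge0 i : 0 <= s i by rewrite /s mulr_ge0// ltW.
pose A (i : 'I_n) : set R := (fun z => z + mu * h) @^-1` D i.
have mA i : measurable (A i).
  rewrite -[X in measurable X]setTI.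
  have mt : measurable_fun setT (fun z : R => z + mu * h).
    exact: measurable_funD.
  exact: mt.
have := bm_indep HB (n := n) s0 (fun i => ltW (slt i)) mA.
rewrite [X in P X](_ : _ =
    [set w | forall i, (i < n)%N -> D i (increment i w)]); last first.
  apply/seteqP; split => w /= H i; last exact: H.
  by move=> i_n; exact: (H (Ordinal i_n)).
move=> ->; apply: eq_bigr => i _.
rewrite (bm_gauss HB (sge0 i) (slt i) (mA i)) sS.
exact: normal_prob_translation.
Qed.

(** The starting point [x] is free although the law of [displacement] does
    not depend on it; this is what allows two starting points to be compared. *)
Lemma grid_law (J : nat -> set R) (D : set R) n (x : R) :
  (forall k, measurable (J k)) -> measurable D ->
  P [set w | (forall k, (k < n)%N -> J k (x + displacement (k.+1%:R * h) w)) /\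
             D (x + displacement (n%:R * h) w)] =
  (grid_op h J \1_D n x)%:E.
Proof.
move=> mJ mD.
have mX i : measurable_fun setT (increment i).
  by apply: measurable_funD => //; exact: measurable_funB.
have := walk_in_law (mu := leb) (w := gauss_kernel (mu * h) (Num.sqrt h))
  (@gauss_kernel_ge0 _ _ _) (measurable_gauss_kernel (mu * h) sh_neq0)
  (integral_gauss_kernel (mu * h) (Num.sqrt h))
  (ge0_integral_gauss_kernel (mu * h) sh_neq0)
  mJ mD (measurable_cst x) mX (independent_future_increment x n).
have -> : (\int[P]_t (killed_op leb (gauss_kernel (mu * h) (Num.sqrt h)) J \1_D n
    (cst x t))%:E = \int[P]_t cst (grid_op h J \1_D n x)%:E t)%E by [].
rewrite integral_cst//= probability_setT mule1 => <-; congr (P _).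
pose p w i := B (i%:R * h) w + mu * (i%:R * h).
have pE w i : displacement (i%:R * h) w = p w i - p w 0%N.
  by rewrite /displacement /p mul0r mulr0; ring.
have Hp w := walk_in_path J D n x (p := p w) (x := increment ^~ w).
have incE w i : increment i w = p w i.+1 - p w i.
  by rewrite /increment /p -natr1; ring.
apply/seteqP; split => w /=; rewrite (Hp _ (incE w)) pE.
  by move=> [H1 H2]; split => // k kn; rewrite -pE; exact: H1.
by move=> [H1 H2]; split => // k kn; rewrite pE; exact: H1.
Qed.

Definition above (lo : R) (n : nat) : set T :=
  [set w | forall k, (k < n)%N -> lo <= displacement (k.+1%:R * h) w].

(** The upper barrier is active only up to time [delta], which need not be a
    point of the grid. *)
Definition between (lo hi delta : R) (n : nat) : set T :=
  [set w | forall k, (k < n)%N -> lo <= displacement (k.+1%:R * h) w /\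
    (k.+1%:R * h <= delta -> displacement (k.+1%:R * h) w <= hi)].

Let Jb (lo hi delta : R) (k : nat) : set R :=
  [set y | lo <= y /\ (k.+1%:R * h <= delta -> y <= hi)].

Let mJb lo hi delta k : measurable (Jb lo hi delta k).
Proof.
rewrite /Jb; case: (leP (k.+1%:R * h) delta) => kd.
  rewrite [X in measurable X](_ : _ = `[lo, hi]%classic)//.
  apply/seteqP; split => y /=; rewrite in_itv/=.
    by move=> [-> /(_ isT)].
  by move=> /andP[].
rewrite [X in measurable X](_ : _ = `[lo, +oo[%classic)//.
apply/seteqP; split => y /=; rewrite in_itv/= andbT => //.
by move=> [].
Qed.

Let Ja (lo : R) (k : nat) : set R := [set y | lo <= y].

Let mJa lo k : measurable (Ja lo k).
Proof.
rewrite /Ja [X in measurable X](_ : _ = `[lo, +oo[%classic)//.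
by apply/seteqP; split => y /=; rewrite in_itv/= andbT.
Qed.

Lemma probability_between lo hi delta n x :
  P (between (lo - x) (hi - x) delta n) =
  (grid_op h (Jb lo hi delta) (cst 1) n x)%:E.
Proof.
have -> : cst 1 = \1_[set: R] :> (R -> R) by rewrite indicT.
rewrite -grid_law//; congr (P _).
apply/seteqP; split => w /=.
  move=> H; split => // k kn; have [H1 H2] := H k kn.
  by split => [|/H2]; lra.
by move=> [H _] k kn; have [H1 H2] := H k kn; split => [|/H2]; lra.
Qed.

Lemma probability_above lo n x :
  P (above (lo - x) n) = (grid_op h (Ja lo) (cst 1) n x)%:E.
Proof.
have -> : cst 1 = \1_[set: R] :> (R -> R) by rewrite indicT.
rewrite -grid_law//; congr (P _).
apply/seteqP; split => w /=.
  by move=> H; split => // k kn; have := H k kn; rewrite /Ja/=; lra.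
by move=> [H _] k kn; have := H k kn; rewrite /Ja/=; lra.
Qed.

Lemma measurable_between lo hi delta n : measurable (between lo hi delta n).
Proof.
rewrite /between [X in measurable X](_ : _ =
   \bigcap_(k in [set k | (k < n)%N]) (displacement (k.+1%:R * h) @^-1` Jb lo hi delta k)).
  apply: bigcap_measurableType => k _; rewrite -[X in measurable X]setTI.
  by apply: measurable_displacement => //; exact: mJb.
by apply/seteqP; split => w /= H k; exact: H.
Qed.

Lemma measurable_above lo n : measurable (above lo n).
Proof.
rewrite /above [X in measurable X](_ : _ =
   \bigcap_(k in [set k | (k < n)%N]) (displacement (k.+1%:R * h) @^-1` Ja lo k)).
  apply: bigcap_measurableType => k _; rewrite -[X in measurable X]setTI.
  by apply: measurable_displacement => //; exact: mJa.
by apply/seteqP; split => w /= H k; exact: H.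
Qed.

Let adm1 : admissible (cst 1 : R -> R).
Proof. by split => // x; rewrite /cst ler01 lexx. Qed.

Let grid_op_four J1 J2 J3 J4 f1 f2 f3 f4 :=
  @killed_op_four R leb (gauss_kernel (mu * h) (Num.sqrt h))
    (@gauss_kernel_ge0 _ _ _) (measurable_gauss_kernel (mu * h) sh_neq0)
    (integral_gauss_kernel (mu * h) (Num.sqrt h)) J1 J2 J3 J4 f1 f2 f3 f4.

(** A walk started at [x] with barriers [l] and [hi] is a displacement with
    barriers [l - x] and [hi - x], so that comparing starting points becomes
    comparing barriers. *)
Lemma between_above_four l1 l2 hi x1 x2 delta n :
  (P (between (l1 - x1) (hi - x1) delta n) * P (above (l2 - x2) n) <=
   P (between (Num.min l1 l2 - Num.min x1 x2) (hi - Num.min x1 x2) delta n) *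
   P (above (Num.max l1 l2 - Num.max x1 x2) n))%E.
Proof.
rewrite !probability_between !probability_above -!EFinM lee_fin.
apply: (grid_op_four (mJb l1 hi delta) (mJa l2) (mJb _ hi delta) (mJa _)
  adm1 adm1 adm1 adm1 (gauss_kernel_TP2 (mu * h) sh_neq0)) => //.
- move=> k y1 y2 [y1l y1h] y2l; rewrite /Jb /Ja/=; split; last first.
    by rewrite ge_max !le_max y1l/= (y2l : l2 <= y2) orbT.
  split.
    by rewrite le_min !ge_min y1l/= (y2l : l2 <= y2) orbT.
  by move=> /y1h y1hi; rewrite ge_min y1hi.
Qed.

(** By the Markov property at time [n], survival over [n + n] steps is the
    killed expectation over [n] steps of the survival probability [u] of the
    second half.  Since [u] is nondecreasing, [u >= u 0] on the half line
    [y >= 0], and ending there is positively correlated with survival. *)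
Lemma above_doubling lo n :
  (P (above lo n) * P (above lo n) * P [set w | 0 <= displacement (n%:R * h) w]%R <=
   P (above lo (n + n)))%E.
Proof.
rewrite -(subr0 lo) !probability_above.
pose pos : set R := `[0, +oo[%classic.
have mpos : measurable pos by exact: measurable_itv.
have apos := admissible_indic mpos.
rewrite [X in (_ * P X)%E](_ : _ =
  [set w | (forall k, (k < n)%N -> setT (0 + displacement (k.+1%:R * h) w)) /\
             pos (0 + displacement (n%:R * h) w)]%R); last first.
  apply/seteqP; split => w /=; rewrite add0r /pos/= in_itv/= andbT => //.
  by move=> [].
rewrite (@grid_law (fun=> setT) pos)// -!EFinM lee_fin.
set one := cst 1 : R -> R.
set c := grid_op h (Ja lo) one n 0.
have adm J f m : (forall k, measurable (J k)) -> admissible f ->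
    admissible (grid_op h J f m).
  exact: (admissible_killed_op (mu := leb) (@gauss_kernel_ge0 _ _ _)
    (measurable_gauss_kernel (mu * h) sh_neq0)
    (integral_gauss_kernel (mu * h) (Num.sqrt h))).
have free y m : grid_op h (fun=> setT) one m y = 1.
  exact: (killed_op_unconstrained (integral_gauss_kernel (mu * h) (Num.sqrt h))).
have c0 : 0 <= c by have [_ /(_ 0)/andP[]] := adm _ _ n (mJa lo) adm1.
(* Four functions at the starting points [0] and [y], where the walk started
   at [y] is unconstrained on the left-hand side and so contributes [1]. *)
have mono y : 0 <= y -> c <= grid_op h (Ja lo) one n y.
  move=> y0.
  have : c * grid_op h (fun=> setT) one n y <=
      grid_op h (fun=> setT) one n (Num.min 0 y) *
      grid_op h (Ja lo) one n (Num.max 0 y).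
    apply: (grid_op_four (mJa lo) (fun=> measurableT) (fun=> measurableT)
      (mJa lo) adm1 adm1 adm1 adm1 (gauss_kernel_TP2 (mu * h) sh_neq0)) => //.
    by move=> k y1 y2 ly1 _; split => //; rewrite /Ja/= le_max (ly1 : lo <= y1).
  by rewrite max_r// !free mulr1 mul1r.
have -> : grid_op h (Ja lo) one (n + n) 0 =
   grid_op h (Ja lo) (grid_op h (Ja lo) one n) n 0.
  exact: killed_op_semigroup.
apply: (@le_trans _ _ (c * grid_op h (Ja lo) \1_pos n 0)).
  rewrite -mulrA; apply: ler_wpM2l => //.
  have : c * grid_op h (fun=> setT) \1_pos n 0 <=
      grid_op h (fun=> setT) one n (Num.min 0 0) *
      grid_op h (Ja lo) \1_pos n (Num.max 0 0).
    apply: (grid_op_four (mJa lo) (fun=> measurableT) (fun=> measurableT)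
      (mJa lo) adm1 apos adm1 apos (gauss_kernel_TP2 (mu * h) sh_neq0)) => //.
      by move=> k y1 y2 ly1 _; split => //; rewrite /Ja/= le_max (ly1 : lo <= y1).
    move=> y1 y2; rewrite /cst !mul1r !indicE ler_nat.
    rewrite /pos !mem_setE !in_itv/= !andbT le_max.
    by case: (0 <= y2); rewrite ?orbT.
  by rewrite maxxx free mul1r.
apply: (killed_op_scale_le (@gauss_kernel_ge0 _ _ _)
    (measurable_gauss_kernel (mu * h) sh_neq0)
    (integral_gauss_kernel (mu * h) (Num.sqrt h))) => //.
- exact: adm.
- move=> y; rewrite indicE /pos mem_setE in_itv/= andbT.
  have [y0|y0] := leP 0 y; first by rewrite mulr1; exact: mono.
  by rewrite mulr0; have [_ /(_ y)/andP[]] := adm _ _ n (mJa lo) adm1.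
Qed.

End fixed_mesh.
End brownian_grid.

(** * Continuous paths and their values on dyadic grids *)

Section paths.
Context {R : realType}.
Implicit Types (x : R -> R) (s t z c : R).

Lemma dyadic_small t e : 0 < t -> 0 < e -> exists m, t / 2 ^+ m < e.
Proof.
move=> t0 e0; pose m := (Num.truncn (t / e)).+1; exists m.
have te : t / e < m%:R by rewrite /m truncnS_gt.
have m2 : (m%:R : R) <= 2 ^+ m by rewrite -natrX ler_nat ltnW// ltn_expl.
by rewrite ltr_pdivrMr ?exprn_gt0// mulrC -ltr_pdivrMr//; exact: lt_le_trans te m2.
Qed.

Lemma dyadic_below t z e : 0 < t -> 0 <= z <= t -> 0 < e ->
  exists m k, [/\ (k <= 2 ^ m)%N, k%:R * (t / 2 ^+ m) <= z &
                  z < k%:R * (t / 2 ^+ m) + e].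
Proof.
move=> t0 /andP[z0 zt] e0.
have [m he] := dyadic_small t0 e0.
set h := t / 2 ^+ m in he.
have p2 : 0 < 2 ^+ m :> R by rewrite exprn_gt0.
have h0 : 0 < h by rewrite divr_gt0.
exists m, (Num.truncn (z / h)).
have zh0 : 0 <= z / h by rewrite divr_ge0// ltW.
have := truncn_itv zh0; rewrite -/h => /andP[].
rewrite ler_pdivlMr// ltr_pdivrMr// => kz zk; split => //.
  rewrite -(ler_nat R) natrX -(ler_pM2r h0) (le_trans kz)//.
  by rewrite /h mulrCA divff ?mulr1// gt_eqF.
by rewrite (lt_trans zk)// -natr1 mulrDl mul1r ltrD2l.
Qed.

Lemma continuous_on_itv x t : {within `[0, +oo[, continuous x} ->
  {within `[0, t], continuous x}.
Proof.
apply: continuous_subspaceW => z /=; rewrite !in_itv/= andbT.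
by case/andP.
Qed.

Lemma continuous_near x z e : {within `[0, +oo[, continuous x} -> 0 <= z -> 0 < e ->
  exists2 r, 0 < r & forall z', 0 <= z' -> `|z' - z| < r -> `|x z' - x z| < e.
Proof.
move=> cx z0 e0.
have xz : x @ within `[0, +oo[ (nbhs z) --> x z.
  by move/subspace_continuousP : cx; apply; rewrite /= in_itv/= z0.
have /cvgrPdist_lt/(_ _ e0) := xz.
rewrite near_withinE => /nbhs_ballP[r /= r0 H].
exists r => // z' z'0 z'z; rewrite distrC; apply: H => /=.
  by rewrite /ball/= distrC.
by rewrite in_itv/= z'0.
Qed.

Definition grid_pt t m k : R := k%:R * (t / 2 ^+ m).

Lemma grid_pt_itv t m k : 0 < t -> (k <= 2 ^ m)%N -> 0 <= grid_pt t m k <= t.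
Proof.
move=> t0 km; have p2 : 0 < 2 ^+ m :> R by rewrite exprn_gt0.
rewrite mulr_ge0//=; last by rewrite divr_ge0// ltW.
rewrite /grid_pt mulrA ler_pdivrMr// mulrC ler_pM2l//.
by rewrite -natrX ler_nat.
Qed.

Lemma grid_ptS t m k : grid_pt t m.+1 (k.*2) = grid_pt t m k.
Proof.
rewrite /grid_pt exprS -muln2 natrM.
by field; rewrite expf_neq0.
Qed.

(** Grid points approaching [z] from below suffice, since there are such
    points arbitrarily close to [z]; restricting to them keeps constraints that
    hold only up to a given time. *)
Lemma ge_of_grid_below x t z c : {within `[0, +oo[, continuous x} ->
  0 < t -> 0 <= z <= t ->
  (forall m k, (k <= 2 ^ m)%N -> grid_pt t m k <= z -> c <= x (grid_pt t m k)) ->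
  c <= x z.
Proof.
move=> cx t0 /andP[z0 zt] H; rewrite leNgt; apply/negP => xc.
have e0 : 0 < c - x z by rewrite subr_gt0.
have [r r0 Hr] := continuous_near cx z0 e0.
have [//|m [k [km kz zk]]] := @dyadic_below t z r t0 _ r0; first by rewrite z0 zt.
have := H _ _ km kz; rewrite leNgt => /negP; apply.
have /andP[g0 _] := grid_pt_itv t0 km.
have := Hr _ g0; rewrite distrC ger0_norm ?subr_ge0// => /(_ _)/ltr_normlW.
by rewrite ltrD2r; apply; rewrite ltrBlDl.
Qed.

Lemma path_min_gtP x t c : {within `[0, +oo[, continuous x} -> 0 <= t ->
  (c < path_min x 0 t) <-> (forall z, 0 <= z <= t -> c < x z).
Proof.
move=> cx t0.
have [z0 z0t z0min] := EVT_min t0 (continuous_on_itv cx).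
have minE : path_min x 0 t = x z0.
  rewrite /path_min; apply/eqP; rewrite eq_le; apply/andP; split.
    apply: ge_inf; last by exists z0.
    by exists (x z0) => _ [z zt <-]; exact: z0min.
  apply: lb_le_inf; first by exists (x z0), z0.
  by move=> _ [z zt <-]; exact: z0min.
rewrite minE; split => [cx0 z zt|H].
  by rewrite (lt_le_trans cx0)//; apply: z0min; rewrite in_itv.
by apply: H; move: z0t; rewrite in_itv.
Qed.

Lemma path_max_ltP x t c : {within `[0, +oo[, continuous x} -> 0 <= t ->
  (path_max x 0 t < c) <-> (forall z, 0 <= z <= t -> x z < c).
Proof.
move=> cx t0.
have [z0 z0t z0max] := EVT_max t0 (continuous_on_itv cx).
have maxE : path_max x 0 t = x z0.
  rewrite /path_max; apply/eqP; rewrite eq_le; apply/andP; split.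
    apply: ge_sup; first by exists (x z0), z0.
    by move=> _ [z zt <-]; exact: z0max.
  apply: ub_le_sup; last by exists z0.
  by exists (x z0) => _ [z zt <-]; exact: z0max.
rewrite maxE; split => [cx0 z zt|H].
  by rewrite (le_lt_trans _ cx0)//; apply: z0max; rewrite in_itv.
by apply: H; move: z0t; rewrite in_itv.
Qed.

(** The infimum over the interval is attained, so it exceeds [c].  The
    margin has the form [e / j.+1] in order to write open events as increasing
    unions of closed ones. *)
Lemma gt_on_itv_margin x t c (e : R) : {within `[0, +oo[, continuous x} -> 0 <= t ->
  0 < e -> (forall z, 0 <= z <= t -> c < x z) ->
  exists j : nat, forall z, 0 <= z <= t -> c + e / j.+1%:R <= x z.
Proof.
move=> cx t0 e0 H.
have [z0 z0t z0min] := EVT_min t0 (continuous_on_itv cx).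
have xc : 0 < x z0 - c by rewrite subr_gt0; apply: H; move: z0t; rewrite in_itv.
exists (Num.truncn (e / (x z0 - c))) => z zt.
apply: (@le_trans _ _ (x z0)); last by apply: z0min; rewrite in_itv.
rewrite addrC -lerBrDr ler_pdivrMr// mulrC -ler_pdivrMr//.
by rewrite ltW// truncnS_gt.
Qed.

End paths.

(** * Real-valued probabilities and monotone limits *)

Section pr.
Context d (T : measurableType d) {R : realType} (P : probability T R).

Definition pr (A : set T) : R := fine (P A).

Lemma prE A : measurable A -> P A = (pr A)%:E.
Proof. by move=> mA; rewrite /pr fineK// fin_num_measure. Qed.

Lemma pr_setT : pr setT = 1.
Proof. by rewrite /pr probability_setT. Qed.

Lemma le_pr A B : measurable A -> measurable B -> A `<=` B -> pr A <= pr B.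
Proof.
move=> mA mB AB; rewrite -lee_fin -!prE//.
by apply: le_measure; rewrite ?inE.
Qed.

Lemma pr_le1 A : measurable A -> pr A <= 1.
Proof. by move=> mA; rewrite -pr_setT; exact: le_pr. Qed.

Lemma pr_setC A : measurable A -> pr (~` A) = 1 - pr A.
Proof.
move=> mA; apply: EFin_inj; rewrite EFinB -!prE//; last exact: measurableC.
exact: probability_setC.
Qed.

Lemma pr_setI_ge A B : measurable A -> measurable B ->
  pr A - (1 - pr B) <= pr (A `&` B).
Proof.
move=> mA mB; rewrite lerBlDr -pr_setC// -lee_fin EFinD -!prE//; last 2 first.
- exact: measurableC.
- exact: measurableI.
apply: (@le_trans _ _ (P ((A `&` B) `|` ~` B))).
  apply: le_measure; rewrite ?inE//.
    by apply: measurableU; [exact: measurableI|exact: measurableC].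
  move=> w Aw; have [Bw|Bw] := pselect (B w); [by left|by right].
by apply: measureU2; [exact: measurableI|exact: measurableC].
Qed.

Lemma pr_ae_eq A B : measurable A -> measurable B ->
  {ae P, forall w, A w <-> B w} -> pr A = pr B.
Proof.
move=> mA mB [N [mN N0 HN]].
have HA (C : set T) : measurable C -> P C = P (C `\` N).
  move=> mC; rewrite [LHS](measureDI P mC mN).
  rewrite [X in (_ + X)%E](_ : _ = 0%E) ?adde0//.
  apply/eqP; rewrite eq_le measure_ge0 andbT -N0.
  apply: le_measure; rewrite ?inE//; first exact: measurableI.
rewrite /pr (HA A mA) (HA B mB); congr (fine (P _)).
apply/seteqP; split => w [Cw Nw]; split => //.
  by have [H _] := contra_notP (@HN w) Nw; exact: H.
by have [_ H] := contra_notP (@HN w) Nw; exact: H.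
Qed.

Lemma cvg_pr_bigcap (F : (set T)^nat) : (forall n, measurable (F n)) ->
  (forall n, F n.+1 `<=` F n) -> pr (F n) @[n --> \oo] --> pr (\bigcap_n F n).
Proof.
move=> mF dF.
have mI : measurable (\bigcap_n F n) by exact: bigcapT_measurable.
apply: fine_cvg; rewrite -prE//.
apply: nonincreasing_cvg_mu => //.
  by rewrite (le_lt_trans (probability_le1 P (mF 0%N)))// ltry.
by apply/nonincreasing_seqP => n; apply/subsetPset.
Qed.

Lemma cvg_pr_bigcup (F : (set T)^nat) : (forall n, measurable (F n)) ->
  (forall n, F n `<=` F n.+1) -> pr (F n) @[n --> \oo] --> pr (\bigcup_n F n).
Proof.
move=> mF dF.
have mI : measurable (\bigcup_n F n) by exact: bigcupT_measurable.
apply: fine_cvg; rewrite -prE//.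
apply: nondecreasing_cvg_mu => //.
by apply/nondecreasing_seqP => n; apply/subsetPset.
Qed.

Lemma pr_four_limit (F1 F2 F3 F4 : (set T)^nat) (l1 l2 l3 l4 : R) :
  pr (F1 n) @[n --> \oo] --> l1 -> pr (F2 n) @[n --> \oo] --> l2 ->
  pr (F3 n) @[n --> \oo] --> l3 -> pr (F4 n) @[n --> \oo] --> l4 ->
  (forall n, pr (F1 n) * pr (F2 n) <= pr (F3 n) * pr (F4 n)) ->
  l1 * l2 <= l3 * l4.
Proof.
move=> c1 c2 c3 c4 H.
by apply: (ler_cvg_to (cvgM c1 c2) (cvgM c3 c4)); apply: nearW.
Qed.

End pr.

(** * Barrier events of continuous processes *)

Section process_events.
Context d (T : measurableType d) {R : realType} (Y : R -> T -> R).
Hypothesis mY : forall z, measurable_fun setT (Y z).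
Hypothesis cY : forall w, {within `[0, +oo[, continuous (fun z => Y z w)}.

Definition ge_on (s c : R) : set T := [set w | forall z, 0 <= z <= s -> c <= Y z w].
Definition gt_on (s c : R) : set T := [set w | forall z, 0 <= z <= s -> c < Y z w].

Lemma measurable_ge_on s c : 0 < s -> measurable (ge_on s c).
Proof.
move=> s0.
rewrite [X in measurable X](_ : _ = \bigcap_m \bigcap_(k in [set k | (k <= 2 ^ m)%N])
    (Y (grid_pt s m k) @^-1` `[c, +oo[)).
  apply: bigcapT_measurable => m; apply: bigcap_measurableType => k _.
  by rewrite -[X in measurable X]setTI; exact: mY.
apply/seteqP; split => w /= H.
  move=> m _ k /= km; rewrite in_itv/= andbT; apply: H; exact: grid_pt_itv.
move=> z zs; apply: (ge_of_grid_below (@cY w) s0 zs) => m k km _.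
by have := H m Logic.I k km; rewrite /= in_itv/= andbT.
Qed.

Lemma gt_on_bigcup s c e : 0 <= s -> 0 < e ->
  gt_on s c = \bigcup_j ge_on s (c + e / j.+1%:R).
Proof.
move=> s0 e0; apply/seteqP; split => w /=.
  by move=> /(gt_on_itv_margin (@cY w) s0 e0)[j H]; exists j.
move=> [j _ H] z zs; apply: lt_le_trans (H z zs).
by rewrite ltrDl divr_gt0.
Qed.

Lemma measurable_gt_on s c : 0 < s -> measurable (gt_on s c).
Proof.
move=> s0; rewrite (gt_on_bigcup c (ltW s0) ltr01).
by apply: bigcupT_measurable => j; exact: measurable_ge_on.
Qed.

(** A path started at [0] stays above [c < 0] for a while, so the events
    increase to the whole space. *)
Lemma cvg_pr_gt_on_dyadic (P : probability T R) t c :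
  0 < t -> c < 0 -> (forall w, Y 0 w = 0) ->
  pr P (gt_on (t / 2 ^+ k) c) @[k --> \oo] --> (1 : R).
Proof.
move=> t0 c0 Y0.
have tk0 k : 0 < t / 2 ^+ k :> R by rewrite divr_gt0// exprn_gt0.
suff : pr P (gt_on (t / 2 ^+ k) c) @[k --> \oo] --> pr P setT by rewrite pr_setT.
rewrite (_ : setT = \bigcup_k gt_on (t / 2 ^+ k) c).
  apply: cvg_pr_bigcup => k; first exact: measurable_gt_on.
  move=> w H z /andP[z0 zk]; apply: H; rewrite z0 (le_trans zk)//.
  by rewrite ler_pM2l// lef_pV2 ?posrE ?exprn_gt0// ler_weXn2l// ler1n.
apply/seteqP; split => // w _.
have Nc : 0 < - c by rewrite oppr_gt0.
have [r r0 Hr] := continuous_near (@cY w) (lexx 0) Nc.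
have [k kr] := dyadic_small t0 r0.
exists k => // z /andP[z0 zk].
have := Hr _ z0; rewrite subr0 Y0 subr0 ger0_norm// => /(_ (le_lt_trans zk kr)).
by rewrite ltr_norml opprK => /andP[].
Qed.

End process_events.

(** * The four functions inequality in continuous time *)

Section brownian_limits.
Context {R : realType} d (T : measurableType d) (P : probability T R)
  (B : R -> {RV P >-> R}) (HB : standard_brownian_motion B) (mu : R).
Local Notation X := (displacement B mu).
Local Notation pr := (pr P).

Lemma continuous_drifted u w :
  {within `[0, +oo[, continuous (fun z => drifted B mu u z w)}.
Proof.
have := bm_continuous HB (w := w); rewrite !subspace_continuousP => H z z0.
rewrite /drifted; apply: cvgD; last first.
  apply: cvgM; first exact: cvg_cst.
  by apply: cvg_within_filter; exact: cvg_id.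
by apply: cvgD; [exact: cvg_cst|exact: H].
Qed.

Lemma continuous_displacement w : {within `[0, +oo[, continuous (fun z => X z w)}.
Proof.
have -> : (fun z => X z w) = (fun z => drifted B mu (- B 0 w) z w).
  by apply/funext => z; rewrite /displacement /drifted; ring.
exact: continuous_drifted.
Qed.

Lemma displacement0 w : X 0 w = 0.
Proof. by rewrite /displacement mulr0 subrr addr0. Qed.

Lemma continuous_displacementN w :
  {within `[0, +oo[, continuous (fun z => - X z w)}.
Proof. move=> y; apply: cvgN; exact: continuous_displacement. Qed.

Definition tube (t lo hi delta : R) : set T :=
  [set w | forall z, 0 <= z <= t -> lo <= X z w /\ (z <= delta -> X z w <= hi)].

Definition open_tube (t lo hi delta : R) : set T :=
  [set w | forall z, 0 <= z <= t -> lo < X z w /\ (z <= delta -> X z w < hi)].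

(** Time [0] is not among the grid times of [between]; there the displacement
    vanishes, whence the conditions on [lo] and [hi]. *)
Lemma tube_bigcap t lo hi delta : 0 < t -> lo <= 0 -> 0 <= hi ->
  tube t lo hi delta = \bigcap_m between B mu (t / 2 ^+ m) lo hi delta (2 ^ m).
Proof.
move=> t0 lo0 hi0; apply/seteqP; split => w /=.
  by move=> H m _ k km; apply: H; exact: (grid_pt_itv (m := m) (k := k.+1)).
move=> H z zt.
have HG m k : (k <= 2 ^ m)%N -> lo <= X (grid_pt t m k) w /\
    (grid_pt t m k <= delta -> X (grid_pt t m k) w <= hi).
  case: k => [_|k km]; last exact: H.
  by rewrite /grid_pt mul0r displacement0.
split.
  apply: (ge_of_grid_below (@continuous_displacement w) t0 zt) => m k km _.
  by case: (HG m k km).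
move=> zd; rewrite -lerN2.
apply: (ge_of_grid_below (@continuous_displacementN w) t0 zt) => m k km kz.
by rewrite lerN2; have [_ ] := HG m k km; apply; exact: le_trans kz zd.
Qed.

Lemma between_refine t lo hi delta m :
  between B mu (t / 2 ^+ m.+1) lo hi delta (2 ^ m.+1) `<=`
  between B mu (t / 2 ^+ m) lo hi delta (2 ^ m).
Proof.
move=> w H k km; rewrite -[k.+1%:R * _]/(grid_pt t m k.+1) -grid_ptS.
by rewrite doubleS; apply: H; rewrite expnS mul2n -doubleS leq_double.
Qed.

(** The value [-1] of [delta] disables the upper barrier. *)
Lemma ge_on_tube t lo : ge_on X t lo = tube t lo 0 (-1).
Proof.
apply/seteqP; split => w H z zt; last by case: (H z zt).
split; first exact: H.
by move=> zm1; move: zt => /andP[z0 _]; lra.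
Qed.

Lemma above_between h lo n : 0 < h -> above B mu h lo n = between B mu h lo 0 (-1) n.
Proof.
move=> h0; apply/seteqP; split => w H k kn; last by case: (H k kn).
split; first exact: H.
by have : 0 < k.+1%:R * h by [rewrite mulr_gt0]; lra.
Qed.

Lemma mesh_gt0 t m : 0 < t -> 0 < t / 2 ^+ m :> R.
Proof. by move=> t0; rewrite divr_gt0// exprn_gt0. Qed.

Lemma cvg_pr_tube t lo hi delta : 0 < t -> lo <= 0 -> 0 <= hi ->
  pr (between B mu (t / 2 ^+ m) lo hi delta (2 ^ m)) @[m --> \oo] -->
  pr (tube t lo hi delta).
Proof.
move=> t0 lo0 hi0; rewrite tube_bigcap//.
apply: cvg_pr_bigcap => m; first exact: measurable_between.
exact: between_refine.
Qed.

Lemma cvg_pr_ge_on t lo : 0 < t -> lo <= 0 ->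
  pr (above B mu (t / 2 ^+ m) lo (2 ^ m)) @[m --> \oo] --> pr (ge_on X t lo).
Proof.
move=> t0 lo0; rewrite ge_on_tube.
under eq_fun do rewrite above_between ?mesh_gt0//.
exact: cvg_pr_tube.
Qed.

Lemma measurable_tube t lo hi delta : 0 < t -> lo <= 0 -> 0 <= hi ->
  measurable (tube t lo hi delta).
Proof.
move=> t0 lo0 hi0; rewrite tube_bigcap//; apply: bigcapT_measurable => m.
exact: measurable_between.
Qed.

Lemma tube_four t l1 l2 hi x1 x2 delta : 0 < t ->
  l1 <= x1 -> l2 <= x2 -> x1 <= hi ->
  pr (tube t (l1 - x1) (hi - x1) delta) * pr (ge_on X t (l2 - x2)) <=
  pr (tube t (Num.min l1 l2 - Num.min x1 x2) (hi - Num.min x1 x2) delta) *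
  pr (ge_on X t (Num.max l1 l2 - Num.max x1 x2)).
Proof.
move=> t0 lx1 lx2 xhi.
apply: (pr_four_limit (P := P)
  (F1 := fun m => between B mu (t / 2 ^+ m) (l1 - x1) (hi - x1) delta (2 ^ m))
  (F2 := fun m => above B mu (t / 2 ^+ m) (l2 - x2) (2 ^ m))
  (F3 := fun m => between B mu (t / 2 ^+ m) (Num.min l1 l2 - Num.min x1 x2)
     (hi - Num.min x1 x2) delta (2 ^ m))
  (F4 := fun m => above B mu (t / 2 ^+ m) (Num.max l1 l2 - Num.max x1 x2) (2 ^ m))).
- by apply: cvg_pr_tube => //; lra.
- by apply: cvg_pr_ge_on => //; lra.
- apply: cvg_pr_tube => //; first by rewrite subr_le0 le_min !ge_min lx1 lx2 orbT.
  by rewrite subr_ge0 ge_min xhi.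
- apply: cvg_pr_ge_on => //.
  by rewrite subr_le0 ge_max !le_max lx1 lx2 orbT.
move=> m; rewrite -lee_fin !EFinM -!prE; last first.
all: try exact: measurable_between.
all: try exact: measurable_above.
apply: (between_above_four HB); exact: mesh_gt0.
Qed.

Lemma open_tubeE t lo hi delta : delta <= t ->
  open_tube t lo hi delta =
  gt_on X t lo `&` gt_on (fun z w => - X z w) delta (- hi).
Proof.
move=> dt; apply/seteqP; split => w /=.
  move=> H; split => z /andP[z0 zs].
    by case: (H z) => //; rewrite z0.
  by rewrite ltrN2; case: (H z) => [|_]; [rewrite z0 (le_trans zs)|exact].
move=> [H1 H2] z zt; split; first exact: H1.
by move=> zd; rewrite -ltrN2; apply: H2; case/andP: zt => ->.
Qed.

Lemma measurable_displacementN z : measurable_fun setT (fun w => - X z w).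
Proof. by apply: measurableT_comp => //; exact: measurable_displacement. Qed.

Lemma measurable_gt_on_displacement t lo : 0 < t -> measurable (gt_on X t lo).
Proof.
move=> t0; apply: measurable_gt_on => //; first exact: measurable_displacement.
exact: continuous_displacement.
Qed.

Lemma measurable_ge_on_displacement t lo : 0 < t -> measurable (ge_on X t lo).
Proof.
move=> t0; apply: measurable_ge_on => //; first exact: measurable_displacement.
exact: continuous_displacement.
Qed.

Lemma measurable_gt_on_displacementN t lo : 0 < t ->
  measurable (gt_on (fun z w => - X z w) t lo).
Proof.
move=> t0; apply: measurable_gt_on => //; first exact: measurable_displacementN.
exact: continuous_displacementN.
Qed.

Lemma measurable_open_tube t lo hi delta : 0 < delta <= t ->
  measurable (open_tube t lo hi delta).
Proof.
move=> /andP[d0 dt]; rewrite open_tubeE//; apply: measurableI.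
  exact: measurable_gt_on_displacement (lt_le_trans d0 dt).
exact: measurable_gt_on_displacementN.
Qed.

Lemma open_tube_bigcup t lo hi delta e : 0 < delta <= t -> 0 < e ->
  open_tube t lo hi delta =
  \bigcup_j tube t (lo + e / j.+1%:R) (hi - e / j.+1%:R) delta.
Proof.
move=> /andP[d0 dt] e0.
have t0 : 0 < t by exact: lt_le_trans d0 dt.
have ej (j k : nat) : (j <= k)%N -> e / k.+1%:R <= e / j.+1%:R.
  by move=> jk; rewrite ler_pM2l// lef_pV2 ?posrE// ler_nat.
apply/seteqP; split => w.
  move=> H.
  have [j1 H1] : exists j : nat, forall z, 0 <= z <= t -> lo + e / j.+1%:R <= X z w.
    apply: (gt_on_itv_margin (@continuous_displacement w)) => //; first exact: ltW.
    by move=> z zt; case: (H z zt).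
  have [j2 H2] : exists j : nat, forall z, 0 <= z <= delta ->
      - hi + e / j.+1%:R <= - X z w.
    apply: (gt_on_itv_margin (@continuous_displacementN w)) => //; first exact: ltW.
    move=> z /andP[z0 zd]; rewrite ltrN2.
    by case: (H z) => [|_]; [rewrite z0 (le_trans zd)|exact].
  exists (maxn j1 j2) => // z zt; split.
    by apply: le_trans (H1 z zt); rewrite lerD2l ej// leq_maxl.
  move=> zd; have /H2 : 0 <= z <= delta by case/andP: zt => ->.
  move: (ej _ _ (leq_maxr j1 j2)).
  by move: (e / (maxn j1 j2).+1%:R) (e / j2.+1%:R) => r r'; lra.
move=> [j _ H] z zt; have [H1 H2] := H z zt.
have e1 : 0 < e / j.+1%:R by rewrite divr_gt0.
split => [|/H2 xhi]; first by rewrite (lt_le_trans _ H1)// ltrDl.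
by rewrite (le_lt_trans xhi)// ltrBlDr ltrDl.
Qed.

Lemma cvg_pr_open_tube t lo hi delta e : 0 < delta <= t -> 0 < e ->
  lo + e <= 0 -> 0 <= hi - e ->
  pr (tube t (lo + e / j.+1%:R) (hi - e / j.+1%:R) delta) @[j --> \oo] -->
  pr (open_tube t lo hi delta).
Proof.
move=> dt e0 lo0 hi0; rewrite (open_tube_bigcup _ _ dt e0).
have t0 : 0 < t by case/andP: dt => d0; exact: lt_le_trans.
have ej j : e / j.+2%:R <= e / j.+1%:R.
  by rewrite ler_pM2l// lef_pV2 ?posrE// ler_nat.
have e1 j : e / j.+1%:R <= e by rewrite ler_pdivrMr// ler_peMr ?ler1n ?ltW.
apply: cvg_pr_bigcup => j.
  by apply: measurable_tube => //; move: (e1 j); move: (e / j.+1%:R) => r; lra.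
move=> w H z zt; have [] := H z zt.
move: (ej j); move: (e / j.+2%:R) (e / j.+1%:R) => r r' rr' H1 H2.
by split => [|/H2]; lra.
Qed.

Lemma cvg_pr_gt_on t lo e : 0 < t -> 0 < e -> lo + e <= 0 ->
  pr (ge_on X t (lo + e / j.+1%:R)) @[j --> \oo] --> pr (gt_on X t lo).
Proof.
move=> t0 e0 lo0.
rewrite (gt_on_bigcup continuous_displacement lo (ltW t0) e0).
have ej j : e / j.+2%:R <= e / j.+1%:R.
  by rewrite ler_pM2l// lef_pV2 ?posrE// ler_nat.
apply: cvg_pr_bigcup => j.
  apply: measurable_ge_on => //; first exact: measurable_displacement.
  exact: continuous_displacement.
move=> w H z zt; move: (H z zt) (ej j).
by move: (e / j.+2%:R) (e / j.+1%:R) => r r'; lra.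
Qed.

(** Limit of the closed version with the barriers tightened by
    [e / j.+1], where [e] is small enough for all four tightened events to leave
    room for the starting point. *)
Lemma open_tube_four t l1 l2 hi x1 x2 delta : 0 < delta <= t ->
  l1 < x1 -> l2 < x2 -> x1 < hi ->
  pr (open_tube t (l1 - x1) (hi - x1) delta) * pr (gt_on X t (l2 - x2)) <=
  pr (open_tube t (Num.min l1 l2 - Num.min x1 x2) (hi - Num.min x1 x2) delta) *
  pr (gt_on X t (Num.max l1 l2 - Num.max x1 x2)).
Proof.
move=> dt lx1 lx2 xhi.
have t0 : 0 < t by case/andP: dt => d0; exact: lt_le_trans.
pose e := Num.min (x1 - l1) (Num.min (x2 - l2) (hi - x1)).
have e0 : 0 < e by rewrite !lt_min !subr_gt0 lx1 lx2.
have e1 : e <= x1 - l1 by rewrite ge_min lexx.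
have e2 : e <= x2 - l2 by rewrite !ge_min lexx orbT.
have e3 : e <= hi - x1 by rewrite !ge_min lexx !orbT.
clearbody e.
have c1 : l1 - x1 + e <= 0 by lra.
have c2 : 0 <= hi - x1 - e by lra.
have c3 : l2 - x2 + e <= 0 by lra.
have c4 : Num.min l1 l2 - Num.min x1 x2 + e <= 0.
  by rewrite /Num.min; case: ifP; case: ifP; lra.
have c5 : 0 <= hi - Num.min x1 x2 - e by rewrite /Num.min; case: ifP; lra.
have c6 : Num.max l1 l2 - Num.max x1 x2 + e <= 0.
  by rewrite /Num.max; case: ifP; case: ifP; lra.
apply: (pr_four_limit (P := P) (cvg_pr_open_tube dt e0 c1 c2)
  (cvg_pr_gt_on t0 e0 c3) (cvg_pr_open_tube dt e0 c4 c5)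
  (cvg_pr_gt_on t0 e0 c6)) => j.
have ej0 : 0 < e / j.+1%:R by rewrite divr_gt0.
have eje : e / j.+1%:R <= e by rewrite ler_pdivrMr// ler_peMr ?ler1n ?ltW.
set r := e / _ in ej0 eje *.
have := @tube_four t (l1 + r) (l2 + r) (hi - r) x1 x2 delta t0.
have -> : Num.min (l1 + r) (l2 + r) = Num.min l1 l2 + r by rewrite addr_minl.
have -> : Num.max (l1 + r) (l2 + r) = Num.max l1 l2 + r by rewrite addr_maxl.
rewrite !(addrAC _ r) !(addrAC _ (- r)); apply; lra.
Qed.

End brownian_limits.

(** * Positivity of the conditioning event *)

Section positivity.
Context {R : realType} d (T : measurableType d) (P : probability T R)
  (B : R -> {RV P >-> R}) (HB : standard_brownian_motion B) (mu : R).
Local Notation X := (displacement B mu).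
Local Notation pr := (pr P).

Lemma measurable_displacement_ge0 s : measurable [set w | 0 <= X s w].
Proof.
rewrite [X in measurable X](_ : _ = X s @^-1` `[0, +oo[).
  by rewrite -[X in measurable X]setTI; exact: measurable_displacement.
by apply/seteqP; split => w /=; rewrite in_itv/= andbT.
Qed.

Lemma pr_displacement_ge0_gt0 s : 0 < s -> 0 < pr [set w | 0 <= X s w].
Proof.
move=> s0; rewrite -lte_fin -prE; last exact: measurable_displacement_ge0.
rewrite (_ : [set w | _] = (fun w => B s w - B 0 w) @^-1` `[- (mu * s), +oo[).
  rewrite (bm_gauss HB (lexx 0) s0)//; apply: normal_prob_gt0.
  by rewrite subr0 gt_eqF// sqrtr_gt0.
by apply/seteqP; split => w /=; rewrite in_itv/= andbT /displacement; lra.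
Qed.

Lemma pr_ge_on_doubling s lo : 0 < s -> lo <= 0 ->
  pr (ge_on X s lo) * pr (ge_on X s lo) * pr [set w | 0 <= X s w] <=
  pr (ge_on X (s + s) lo).
Proof.
move=> s0 lo0.
have ss0 : 0 < s + s by rewrite addr_gt0.
have c1 := cvg_pr_ge_on HB (mu := mu) s0 lo0.
have c2 := cvg_pr_ge_on HB (mu := mu) ss0 lo0.
rewrite -cvg_shiftS/= in c2.
apply: (ler_cvg_to (cvgM (cvgM c1 c1) (cvg_cst (pr [set w | 0 <= X s w]))) c2).
apply: nearW => m.
have h0 : 0 < s / 2 ^+ m by exact: mesh_gt0.
have -> : (s + s) / 2 ^+ m.+1 = s / 2 ^+ m.
  by rewrite exprS; field; rewrite expf_neq0.
rewrite -lee_fin !EFinM -!prE; try exact: measurable_above;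
  try exact: measurable_displacement_ge0.
have := above_doubling HB mu h0 lo (2 ^ m).
rewrite addnn -mul2n -expnS.
by rewrite natrX mulrCA divff ?mulr1// expf_neq0.
Qed.

(** The probability is positive over [[0, t / 2 ^ k]] for some [k], and
    [pr_ge_on_doubling] propagates this to [[0, t]] in [k] steps. *)
Lemma pr_ge_on_gt0 t lo : 0 < t -> lo < 0 -> 0 < pr (ge_on X t lo).
Proof.
move=> t0 lo0.
have cv := cvg_pr_gt_on_dyadic (measurable_displacement B mu)
  (@continuous_displacement _ _ _ _ _ HB mu) P t0 lo0 (displacement0 B mu).
have [k _ /(_ k (leqnn k)) /= kpos] : \forall k \near \oo, 0 < pr (gt_on X (t / 2 ^+ k) lo).
  exact: (cvgr_gt _ cv).
have {}kpos : 0 < pr (ge_on X (t / 2 ^+ k) lo).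
  apply: lt_le_trans kpos _; apply: le_pr.
  - by apply: measurable_gt_on_displacement => //; exact: mesh_gt0.
  - by apply: measurable_ge_on_displacement => //; exact: mesh_gt0.
  - by move=> w H z zt; exact/ltW/H.
elim: k kpos => [|k IH]; first by rewrite expr0 divr1.
move=> kpos; apply: IH.
have h0 : 0 < t / 2 ^+ k.+1 by exact: mesh_gt0.
have -> : t / 2 ^+ k = t / 2 ^+ k.+1 + t / 2 ^+ k.+1.
  by rewrite exprS; field; rewrite expf_neq0.
apply: lt_le_trans (pr_ge_on_doubling h0 (ltW lo0)).
by rewrite !mulr_gt0// pr_displacement_ge0_gt0.
Qed.

Lemma pr_gt_on_gt0 t lo : 0 < t -> lo < 0 -> 0 < pr (gt_on X t lo).
Proof.
move=> t0 lo0; have lo2 : lo / 2 < 0 by lra.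
apply: lt_le_trans (pr_ge_on_gt0 t0 lo2) _; apply: le_pr.
- exact: measurable_ge_on_displacement.
- exact: measurable_gt_on_displacement.
- by move=> w H z zt; have := H z zt; lra.
Qed.

End positivity.

(** * The conditional probability as a ratio *)

Section displacement_events.
Context {R : realType} d (T : measurableType d) (P : probability T R)
  (B : R -> {RV P >-> R}) (HB : standard_brownian_motion B) (mu : R).
Local Notation X := (displacement B mu).
Local Notation pr := (pr P).

Lemma path_max_displacementE u delta eta : 0 < delta ->
  [set w | path_max (fun z => `|drifted B mu u z w - drifted B mu u 0 w|) 0 delta
           < eta] =
  gt_on X delta (- eta) `&` gt_on (fun z w => - X z w) delta (- eta).
Proof.
move=> d0.
have E w z : drifted B mu u z w - drifted B mu u 0 w = X z w.
  by rewrite /drifted /displacement; ring.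
have cabs w : {within `[0, +oo[, continuous
    (fun z => `|drifted B mu u z w - drifted B mu u 0 w|)}.
  rewrite (_ : (fun z => _) = fun z => `|X z w|); last first.
    by apply/funext => z; rewrite E.
  by move=> z; apply: cvg_norm; exact: continuous_displacement.
apply/seteqP; split => w /=; rewrite (path_max_ltP _ (@cabs w) (ltW d0)).
  by move=> H; split => z /H; rewrite E ltr_norml => /andP[] /=; rewrite ?ltrN2.
move=> [H1 H2] z zd; rewrite E ltr_norml (H1 _ zd)/=.
by have := H2 _ zd; rewrite ltrN2.
Qed.

Lemma path_min_driftedE u v t : 0 < t ->
  [set w | path_min (fun z => drifted B mu u z w) 0 t > v] =
  gt_on (drifted B mu u) t v.
Proof.
move=> t0; apply/seteqP; split => w /=;
  by rewrite (path_min_gtP _ (@continuous_drifted _ _ _ _ _ HB mu u w) (ltW t0)).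
Qed.

Lemma measurable_gt_on_drifted u v t : 0 < t ->
  measurable (gt_on (drifted B mu u) t v).
Proof.
move=> t0; apply: measurable_gt_on => //; last exact: continuous_drifted.
by move=> z; apply: measurable_funD => //; exact: measurable_funD.
Qed.

Lemma drifted_displacement u z w : B 0 w = 0 -> drifted B mu u z w = u + X z w.
Proof. by move=> B0; rewrite /drifted /displacement B0; ring. Qed.

Lemma pr_path_min u v t : 0 < t ->
  pr [set w | path_min (fun z => drifted B mu u z w) 0 t > v] =
  pr (gt_on X t (v - u)).
Proof.
move=> t0; rewrite path_min_driftedE//; apply: pr_ae_eq.
- exact: measurable_gt_on_drifted.
- exact: measurable_gt_on_displacement.
apply: filterS (bm_start HB) => w B0; split => H z zt; have := H z zt;
  by rewrite drifted_displacement// ltrBlDl.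
Qed.

(** Below [eta], the initial distance [u - v] to the barrier makes the lower
    half of [|X| < eta] a consequence of the conditioning.  The equality of
    events holds only almost surely, because [B 0 = 0] does. *)
Lemma pr_path_max_path_min u v t delta eta : 0 < delta <= t -> u - v <= eta ->
  pr ([set w | path_max (fun z => `|drifted B mu u z w - drifted B mu u 0 w|) 0 delta
           < eta] `&`
      [set w | path_min (fun z => drifted B mu u z w) 0 t > v]) =
  pr (open_tube B mu t (v - u) eta delta).
Proof.
move=> /andP[d0 dt] uv.
have t0 : 0 < t by exact: lt_le_trans d0 dt.
rewrite path_min_driftedE// path_max_displacementE//; apply: pr_ae_eq.
- apply: measurableI; last exact: measurable_gt_on_drifted.
  apply: measurableI; first exact: measurable_gt_on_displacement.
  exact: measurable_gt_on_displacementN.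
- by apply: measurable_open_tube => //; rewrite d0.
apply: filterS (bm_start HB) => w B0; rewrite open_tubeE//; split.
  move=> [[H1 H2] H3]; split => // z zt.
  by have := H3 z zt; rewrite drifted_displacement// ltrBlDl.
move=> [H1 H2]; split; last first.
  by move=> z zt; rewrite drifted_displacement// -ltrBlDl; exact: H1.
split => // z /andP[z0 zd]; have := H1 z; rewrite z0 (le_trans zd dt) => /(_ isT).
by apply: le_lt_trans; lra.
Qed.

End displacement_events.

Unset Implicit Arguments.

Theorem corollary3p2 (R : realType) (d : measure_display)
    (T : measurableType d) (P : probability T R) (B : R -> {RV P >-> R})
    (HB : standard_brownian_motion B)
    (mu v t : R) (ht : 0 < t) (eta : R) (heta : 0 < eta) :
  exists g : R -> R,
    (forall delta : R, 0 < delta < t ->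
      cond_prob P
        [set w | path_max (fun z => `|drifted B mu u z w - drifted B mu u 0 w|)
                   0 delta < eta]
        [set w | path_min (fun z => drifted B mu u z w) 0 t > v]
        @[u --> v^'+] --> g delta) /\
    g delta @[delta --> 0^'+] --> (1 : R).
Proof.
pose X := displacement B mu.
pose f delta u := cond_prob P
  [set w | path_max (fun z => `|drifted B mu u z w - drifted B mu u 0 w|)
             0 delta < eta]
  [set w | path_min (fun z => drifted B mu u z w) 0 t > v].
pose I := `]v, v + eta[%classic.
pose b := eta / 2.
have b0 : 0 < b by rewrite /b; lra.
pose tube lo hi delta := pr P (open_tube B mu t lo hi delta).
pose A lo := pr P (gt_on X t lo).
pose Q delta := pr P (gt_on (fun z w => - X z w) delta (- b)).
have A0 lo : lo < 0 -> 0 < A lo by exact: (pr_gt_on_gt0 HB mu ht).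
have dle delta : 0 < delta < t -> 0 < delta <= t by move=> /andP[-> /ltW].
have fE delta u : 0 < delta < t -> u \in `]v, v + eta[ ->
    f delta u = tube (v - u) eta delta / A (v - u).
  rewrite in_itv/= => dt /andP[vu uv].
  rewrite /f /cond_prob -/(pr P _) -/(pr P _) (pr_path_min HB)//.
  rewrite (pr_path_max_path_min HB mu (dle _ dt))//; lra.
(* One starting point, barriers [v - u] and [v - u']. *)
have f_nd delta : 0 < delta < t ->
    {in `]v, v + eta[ &, {homo f delta : u u' / u <= u'}}.
  move=> dt u u' uI u'I uu'; rewrite !fE//.
  move: uI u'I; rewrite !in_itv/= => /andP[vu uv] /andP[vu' uv'].
  have l0 : v - u < 0 by lra.
  have l0' : v - u' < 0 by lra.
  have ll' : v - u' <= v - u by lra.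
  have := open_tube_four HB mu (dle _ dt) l0 l0' heta.
  rewrite !minxx !maxxx !subr0 (min_r ll') (max_l ll') => H.
  by rewrite ler_pdivrMr ?A0// mulrAC ler_pdivlMr ?A0.
have f_le1 delta u : 0 < delta < t -> u \in `]v, v + eta[ -> f delta u <= 1.
  move=> dt uI; rewrite fE//; move: uI; rewrite in_itv/= => /andP[vu uv].
  rewrite ler_pdivrMr ?A0 ?subr_lt0// mul1r; apply: le_pr.
  - by apply: measurable_open_tube => //; exact: dle.
  - exact: measurable_gt_on_displacement.
  - by move=> w H z zt; case: (H z zt).
(* One barrier, starting points [b] and [0]; the bound is uniform in [u]. *)
have f_ge delta u : 0 < delta < t -> u \in `]v, v + eta[ ->
    1 - (1 - Q delta) / A (- b) <= f delta u.
  move=> dt uI; rewrite fE//; move: uI; rewrite in_itv/= => /andP[vu uv].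
  have l0 : v - u < 0 by lra.
  have lb : v - u < b by lra.
  have beta : b < eta by rewrite /b; lra.
  have := open_tube_four HB mu (dle _ dt) lb l0 beta.
  rewrite !minxx !maxxx (min_r (ltW b0)) (max_l (ltW b0)) !subr0 => H.
  have lb0 : v - u - b < 0 by lra.
  apply: (@le_trans _ _ (tube (v - u - b) (eta - b) delta / A (v - u - b))); last first.
    by rewrite ler_pdivrMr ?A0// mulrAC ler_pdivlMr ?A0.
  have bb : - (eta - b) = - b by rewrite /b; lra.
  have T1 : A (v - u - b) - (1 - Q delta) <= tube (v - u - b) (eta - b) delta.
    rewrite /tube open_tubeE ?bb; last by case/andP: dt => _ /ltW.
    apply: pr_setI_ge.
      exact: measurable_gt_on_displacement.
    by apply: measurable_gt_on_displacementN => //; case/andP: dt.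
  have Q1 : 0 <= 1 - Q delta.
    rewrite subr_ge0; apply: pr_le1.
    by apply: measurable_gt_on_displacementN => //; case/andP: dt.
  have AA : A (- b) <= A (v - u - b).
    apply: le_pr; [exact: measurable_gt_on_displacement..|].
    by move=> w W z zt; have := W z zt; apply: lt_trans; lra.
  have Ab : 0 < A (- b) by apply: A0; rewrite oppr_lt0.
  rewrite ler_pdivlMr ?A0//; apply: le_trans T1.
  rewrite mulrBl mul1r lerD2l lerN2.
  by rewrite mulrAC ler_pdivlMr// ler_wpM2l.
exists (fun delta => inf (f delta @` I)); split.
  move=> delta dt; apply: (@nondecreasing_at_right_cvgr R (f delta) v (BLeft (v + eta))).
  - by rewrite bnd_simp/= ltrDl.
  - exact: f_nd.
  - exists (1 - (1 - Q delta) / A (- b)) => _ [u uI <-]; exact: f_ge.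
have g_bounds delta : 0 < delta < t ->
    1 - (1 - Q delta) / A (- b) <= inf (f delta @` I) <= 1.
  move=> dt.
  have vbI : v + b \in `]v, v + eta[ by rewrite in_itv/= /b; lra.
  apply/andP; split.
    apply: lb_le_inf; first by exists (f delta (v + b)), (v + b).
    by move=> _ [u uI <-]; exact: f_ge.
  apply: (@le_trans _ _ (f delta (v + b))); last exact: f_le1.
  apply: ge_inf; last by exists (v + b).
  by exists (1 - (1 - Q delta) / A (- b)) => _ [u uI <-]; exact: f_ge.
apply/cvgrPdist_le => e e0.
have Ab : 0 < A (- b) by apply: A0; rewrite oppr_lt0.
have Nb : - b < 0 by rewrite oppr_lt0.
have cv := cvg_pr_gt_on_dyadic (measurable_displacementN B mu)
  (@continuous_displacementN _ _ _ _ _ HB mu) P ht Nb _.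
have [k _ /(_ k (leqnn k)) /= kQ] :
    \forall k \near \oo, 1 - e * A (- b) < Q (t / 2 ^+ k).
  apply: (cvgr_gt _ (cv _)); first by move=> w; rewrite displacement0 oppr0.
  by rewrite ltrBlDr ltrDl mulr_gt0.
have tk0 : 0 < t / 2 ^+ k by exact: mesh_gt0.
near=> delta.
have d0 : 0 < delta by near: delta; exact: nbhs_right_gt.
have dt : 0 < delta < t by rewrite d0/=; near: delta; exact: nbhs_right_lt.
have dk : delta < t / 2 ^+ k by near: delta; exact: nbhs_right_lt.
have /andP[g1 g2] := g_bounds delta dt.
rewrite ger0_norm ?subr_ge0// lerBlDr -lerBlDl (le_trans _ g1)//.
rewrite lerD2l lerN2 ler_pdivrMr//.
have : Q (t / 2 ^+ k) <= Q delta.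
  apply: le_pr; [exact: measurable_gt_on_displacementN..|].
  by move=> w W z /andP[z0 zd]; apply: W; rewrite z0 (le_trans zd (ltW dk)).
by move: kQ; lra.
Unshelve. all: by end_near. Qed.
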